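(* Let $k\ge3$ and let $1\le n_1\le\cdots\le n_k$ be integers. Then $\sigma_5(\mathbf{P}^{n_1}\times\cdots\times\mathbf{P}^{n_k})$ is non-defective, with exactly the following exceptions (in which it is defective): (a) $k=3$ and $(n_1,n_2,n_3)=(2,3,3)$; (b) $k=3$ and $(n_1,n_2,n_3)=(1,2,a)$ with $a\ge5$; (c) $k=3$ and $(n_1,n_2,n_3)=(1,3,a)$ with $a\ge5$; (d) $k=4$ and $(n_1,n_2,n_3,n_4)=(1,1,2,2)$.
   Context: Work over a field of characteristic zero (not necessarily algebraically closed). $\mathbf{P}^{n_1}\times\cdots\times\mathbf{P}^{n_k}$ denotes the Segre variety embedded in $\mathbf{P}(V_1\otimes\cdots\otimes V_k)$, where $\dim V_i=n_i+1$. For a variety $X\subseteq\mathbf{P}^m$, the $s$-secant variety $\sigma_s(X)$ is the Zariski closure of the union of the linear spans of $s$-tuples of points of $X$. For the Segre variety $X$, $\sigma_s(X)$ is called non-defective if it has the expected dimension $\min\{\prod_{i=1}^k(n_i+1)-1,\ s\sum_{i=1}^kn_i+s-1\}$, and defective if its dimension is smaller. *)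

(* Defs.v *)
From HB Require Import structures.
From mathcomp Require Import all_boot all_order all_algebra.
From mathcomp Require Import mpoly.

Set Implicit Arguments.
Unset Strict Implicit.
Unset Printing Implicit Defensive.

Import GRing.Theory.
Local Open Scope ring_scope.

(* Projective space with N homogeneous coordinates, i.e. P^(N-1)(F): its points
   are the one-dimensional subspaces of F^N. *)
Definition proj_space (F : fieldType) (N : nat) : Type :=
  {L : {vspace 'rV[F]_N} | \dim L == 1%N}.

Section ProjectiveGeometry.
Variables (F : fieldType) (N : nat).
Implicit Types (X Z : proj_space F N -> Prop) (p : {mpoly F[N]}).

Definition vanishes_at p (L : proj_space F N) : Prop :=
  forall v : 'rV[F]_N, v \in val L -> p.@[v 0] = 0.

Definition zariski_closed Z : Prop :=
  exists S : {mpoly F[N]} -> Prop,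
    (forall p, S p -> exists d : nat, p \is d.-homog) /\
    (forall L, Z L <-> (forall p, S p -> vanishes_at p L)).

Definition zariski_closure X : proj_space F N -> Prop :=
  fun L => forall Z, zariski_closed Z -> (forall M, X M -> Z M) -> Z L.

(* The vanishing ideal I(X).  As polynomials are required to vanish on the whole
   line of each point, over an infinite field this is the homogeneous ideal
   generated by the forms vanishing on X. *)
Definition vanishing_ideal X : {mpoly F[N]} -> Prop :=
  fun p => forall L, X L -> vanishes_at p L.

(* The classes of f_1, ..., f_r in the homogeneous coordinate ring
   F[x_1, ..., x_N] / I(X) are algebraically independent over F. *)
Definition alg_independent_on X (r : nat) (f : r.-tuple {mpoly F[N]}) : Prop :=
  forall q : {mpoly F[r]}, vanishing_ideal X (q \mPo f) -> q = 0.

(* dim X = d: the homogeneous coordinate ring of X has transcendence degree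
   d + 1 over F. *)
Definition has_dim X (d : nat) : Prop :=
  (exists f : d.+1.-tuple {mpoly F[N]}, alg_independent_on X f) /\
  ~ (exists f : d.+2.-tuple {mpoly F[N]}, alg_independent_on X f).

Definition secant_variety (s : nat) X : proj_space F N -> Prop :=
  zariski_closure (fun L =>
    exists P : s.-tuple (proj_space F N),
      (forall i, X (tnth P i)) /\
      (val L <= \sum_(i < s) val (tnth P i))%VS).

End ProjectiveGeometry.

(* The index set of the coordinates of V_1 (x) ... (x) V_k,
   where V_i = F^(n_i + 1). *)
Definition tensor_index (k : nat) (n : k.-tuple nat) : finType :=
  {dffun forall i : 'I_k, 'I_(tnth n i).+1}.

Definition pure_tensor (F : fieldType) (k : nat) (n : k.-tuple nat)
    (v : forall i : 'I_k, 'rV[F]_(tnth n i).+1) : 'rV[F]_#|tensor_index n| :=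
  \row_j \prod_(i < k) v i 0 ((enum_val j : tensor_index n) i).

Definition segre (F : fieldType) (k : nat) (n : k.-tuple nat) :
    proj_space F #|tensor_index n| -> Prop :=
  fun L => exists v : forall i : 'I_k, 'rV[F]_(tnth n i).+1,
    (forall i, v i != 0) /\ val L = <[pure_tensor v]>%VS.

Definition expected_dim (s k : nat) (n : k.-tuple nat) : nat :=
  minn ((\prod_(i < k) (tnth n i).+1) - 1)
       (s * (\sum_(i < k) tnth n i) + s - 1).

Definition segre_nondefective (F : fieldType) (s k : nat) (n : k.-tuple nat) :
    Prop :=
  has_dim (secant_variety s (@segre F k n)) (expected_dim s n).

Definition segre_defective (F : fieldType) (s k : nat) (n : k.-tuple nat) :
    Prop :=
  exists d : nat, has_dim (secant_variety s (@segre F k n)) d /\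
    (d < expected_dim s n)%N.

(* Main.v *)
Require Import Defs.
From HB Require Import structures.
From mathcomp Require Import all_boot all_order all_algebra.
From mathcomp Require Import mpoly zify ring.
From Stdlib Require Import Classical.
From Stdlib Require BinNat Nnat.

Set Implicit Arguments.
Unset Strict Implicit.
Unset Printing Implicit Defensive.

Import GRing.Theory.
Module N := BinNat.N.

(** In characteristic zero the dimension of a variety parametrized by
    polynomials is the generic rank of the Jacobian matrix, minus one in the
    projective setting: gradients that are independent at one point force the
    functions to be algebraically independent ([jacobian_alg_indep]), and
    algebraically independent functions have independent gradients at a
    generic point ([alg_indep_jacobian]). The affine cone over the fifth
    secant variety is parametrized by the factors of five pure tensors, and
    the Jacobian matrix spans the sum of the tangent spaces at the five
    summands. So everything is a matter of computing the dimension of the sum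
    of five general tangent spaces; call (n_1, ..., n_k) the format.

    The sum has at most as many dimensions as there are coordinates, and, as
    factors can be rescaled against each other, at most 5 (n_1 + ... + n_k + 1)
    ([rank_le_normalized]). In an exceptional format, further hyperplanes
    contain all the tangent spaces. For (1,2,a) and (1,3,a) they come from
    the fact that the 6 or 8 by a+1 flattening has rank at most five
    ([rank_unbalanced]); for (1,1,2,2) from two 6 by 6 flattenings that become
    singular ([conormals_1122]); for (2,3,3) they are the forms
    det(x, w y, u z) where w and u map the second and third factor of every
    summand into the line of the first ([conormals_233]).

    Conversely, a lower bound at one point is enough. Independence of five
    tangent spaces persists when the format grows
    ([independent_tangents_extend]), and if they fill the space, they still do
    when the format shrinks ([rank_full_truncate]). This reduces the claim to
    seven formats, in which independence at explicit integral points is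
    verified by elimination modulo a prime ([base_formats_independent]). Three
    of them are perfect, that is, five independent tangent spaces have
    exactly the dimension of the whole space, and so they settle the smaller
    formats too. Only (1,1,a) remains, where four summands fill the space
    ([nondefective_11a]). *)

(** * Algebraic independence and Jacobian matrices *)

Section Polynomials.
Local Open Scope ring_scope.
Variable F : fieldType.

Lemma digits_inj n B (a b : 'I_n -> nat) :
    (forall i, a i < B)%N -> (forall i, b i < B)%N ->
  (\sum_i a i * B ^ i = \sum_i b i * B ^ i)%N -> a =1 b.
Proof.
elim: n => [|n IHn] in a b * => ltaB ltbB; first by move=> _ [].
have split (c : 'I_n.+1 -> nat) : (\sum_i c i * B ^ i
    = (\sum_(i < n) c (lift ord0 i) * B ^ i) * B + c ord0)%N.
  rewrite big_ord_recl expn0 muln1 addnC big_distrl /=; congr (_ + _)%N.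
  by apply: eq_bigr => i _; rewrite /bump /= expnSr mulnA.
rewrite !split => eq_ab.
have B_gt0 : (0 < B)%N by apply: leq_ltn_trans (ltaB ord0).
have eq0 : a ord0 = b ord0.
  by have:= congr1 (modn^~ B) eq_ab; rewrite !modnMDl !modn_small.
have /IHn eqS : (\sum_(i < n) a (lift ord0 i) * B ^ i
    = \sum_(i < n) b (lift ord0 i) * B ^ i)%N.
  by apply/eqP; rewrite -(eqn_pmul2r B_gt0) -(eqn_add2r (a ord0)) eq_ab eq0.
move=> i; case: (unliftP ord0 i) => [j ->|-> //].
by apply: eqS => k.
Qed.

Hypothesis charF0 : [pchar F] =i pred0.

Lemma natr_inj : injective (fun a : nat => a%:R : F).
Proof.
move=> a b; wlog le_ab : a b / (a <= b)%N.
  by move=> H; case/orP: (leq_total a b) => /H // H1 /esym/H1.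
move/eqP; rewrite eq_sym -subr_eq0 -natrB // ((pcharf0P F).1 charF0) subn_eq0.
by move=> le_ba; apply/eqP; rewrite eqn_leq le_ab.
Qed.

Lemma poly_nonroot (P : {poly F}) : P != 0 -> exists t, P.[t] != 0.
Proof.
move=> nz_P; have: ~~ all (root P) [seq i%:R | i <- iota 0 (size P)].
  apply/negP => /max_poly_roots-/(_ nz_P).
  rewrite size_map size_iota ltnn => /implyP; rewrite implybF => /negP; apply.
  by rewrite map_inj_uniq ?iota_uniq //; apply: natr_inj.
by case/allPn => t _ nroot; exists t.
Qed.

(** Kronecker's substitution X_i := T^(B^i) keeps monomials of degree less
    than B apart, which reduces the claim to polynomials in one variable. *)
Lemma mpoly_nonroot n (p : {mpoly F[n]}) :
  p != 0 -> exists v, p.@[v] != 0.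
Proof.
move=> nz_p; pose B := msize p.
pose e (m : 'X_{1..n}) := (\sum_(i < n) m i * B ^ i)%N.
pose P : {poly F} := \sum_(m <- msupp p) p@_m *: 'X^(e m).
have eval t : P.[t] = p.@[fun i => t ^+ (B ^ i)].
  rewrite mevalE horner_sum; apply: eq_bigr => m _.
  rewrite hornerZ hornerXn; congr (_ * _); rewrite /e expr_sum.
  by apply: eq_bigr => i _; rewrite mulnC exprM.
have degB m : m \in msupp p -> forall i, (m i < B)%N.
  move=> mp i; apply: leq_ltn_trans (msize_mdeg_lt mp).
  by rewrite mdegE (bigD1 i) //= leq_addr.
have P_neq0 : P != 0.
  have mp := mlead_supp nz_p; apply: contraTneq mp => P0.
  suff: P`_(e (mlead p)) = mleadc p.
    by rewrite P0 coef0 => /esym/eqP; rewrite mcoeff_eq0.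
  rewrite coef_sum (bigD1_seq (mlead p)) ?mlead_supp ?msupp_uniq //=.
  rewrite coefZ coefXn eqxx mulr1 big_seq_cond big1 ?addr0 // => m /andP[mp ne].
  rewrite coefZ coefXn; case: eqP => [eqe|]; last by rewrite mulr0.
  case/eqP: ne; apply/mnmP; apply: (digits_inj _ _ (esym eqe)); apply: degB => //.
  exact: mlead_supp.
have [t nroot] := poly_nonroot P_neq0; exists (fun i => t ^+ (B ^ i)).
by rewrite -eval.
Qed.

Lemma mderivXU n (k i : 'I_n) : ('X_k : {mpoly F[n]})^`M(i) = (k == i)%:R.
Proof.
rewrite mderivX mnm1E; case: eqP => [->|_]; last by rewrite scale0r.
by rewrite -{1}[U_(i)%MM]addm0 addmC addmK mpolyX0 scale1r.
Qed.

Lemma mderiv_comp n m (p : {mpoly F[n]}) (f : n.-tuple {mpoly F[m]}) j :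
  (p \mPo f)^`M(j) = \sum_i (p^`M(i) \mPo f) * (tnth f i)^`M(j).
Proof.
pose chain (q : {mpoly F[n]}) : Prop :=
  (q \mPo f)^`M(j) = \sum_i (q^`M(i) \mPo f) * (tnth f i)^`M(j).
have chain_lin c q1 q2 : chain q1 -> chain q2 -> chain (c *: q1 + q2).
  rewrite /chain linearP mderivD mderivZ => -> ->; rewrite scaler_sumr -big_split.
  apply: eq_bigr => i _; rewrite /= mderivD mderivZ linearP /= mulrDl.
  by rewrite scalerAl.
have chain_mul q1 q2 : chain q1 -> chain q2 -> chain (q1 * q2).
  rewrite /chain rmorphM mderivM => -> ->; rewrite mulr_suml mulr_sumr -big_split.
  apply: eq_bigr => i _; rewrite /= mderivM rmorphD !rmorphM /= mulrDl.
  by rewrite mulrAC mulrA.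
have chain1 : chain 1.
  rewrite /chain rmorph1 -mpolyC1 mderivC big1 // => i _.
  by rewrite -mpolyC1 mderivC rmorph0 mul0r.
have chainX k : chain 'X_k.
  rewrite /chain comp_mpolyXU -tnth_nth (bigD1 k) //= big1 => [|i ne_ik].
    by rewrite addr0 mderivXU eqxx rmorph1 mul1r.
  by rewrite mderivXU eq_sym (negPf ne_ik) rmorph0 mul0r.
have chainXn k e : chain ('X_k ^+ e).
  by elim: e => [|e IHe]; rewrite ?expr0 // exprS; apply: chain_mul.
rewrite -/(chain p); elim/mpolyind: p => [|c m0 p _ _ IHp].
  by rewrite /chain rmorph0 linear0 big1 // => i _; rewrite linear0 rmorph0 mul0r.
apply: chain_lin IHp; rewrite mpolyXE_id.
by apply: (big_ind chain) => // i _; apply: chainXn.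
Qed.

Definition alg_indep n m (g : n.-tuple {mpoly F[m]}) : Prop :=
  forall q : {mpoly F[n]}, q \mPo g = 0 -> q = 0.

Definition jacobian n m (g : n.-tuple {mpoly F[m]}) (v : 'I_m -> F) : 'M[F]_(n, m) :=
  \matrix_(i, j) ((tnth g i)^`M(j)).@[v].

Lemma msize_mul_le n (p q : {mpoly F[n]}) a b :
  (msize p <= a.+1 -> msize q <= b.+1 -> msize (p * q) <= (a + b).+1)%N.
Proof.
have [->|nz_p] := eqVneq p 0; first by rewrite mul0r msize0.
have [->|nz_q] := eqVneq q 0; first by rewrite mulr0 msize0.
rewrite msizeM // => le_p le_q.
have := leq_add le_p le_q; rewrite addSn addnS.
by case: (msize p + msize q)%N => // k; rewrite ltnS.
Qed.

Lemma card_bounded_monomials m B : (#|{: 'X_{1..m < B.+1}}| <= B.+1 ^ m)%N.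
Proof.
pose f (b : 'X_{1..m < B.+1}) : {ffun 'I_m -> 'I_B.+1} := [ffun i => inord (bmnm b i)].
have inj_f : injective f.
  move=> b c /ffunP eq_f; apply/eqP; rewrite bmeqP; apply/eqP/mnmP => i.
  have ltB (d : 'X_{1..m < B.+1}) : (bmnm d i < B.+1)%N.
    by apply: leq_ltn_trans (bmdeg d); rewrite mdegE (bigD1 i) //= leq_addr.
  by have:= eq_f i; rewrite !ffunE => /(congr1 val); rewrite /= !inordK.
by have:= leq_card f inj_f; rewrite card_ffun !card_ord.
Qed.

(** Counting: the D^n monomials of degree < D in each of n independent
    polynomials are linearly independent, but they live in the space of
    polynomials of degree O(D), whose dimension is O(D^m). *)
Lemma alg_indep_leq n m (g : n.-tuple {mpoly F[m]}) : alg_indep g -> (n <= m)%N.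
Proof.
move=> ind_g; rewrite leqNgt; apply/negP => lt_mn.
pose e := \max_(i < n) msize (tnth g i).
pose D := ((n * e).+1 ^ m).+1; pose B := (D * (n * e))%N.
pose A := {ffun 'I_n -> 'I_D}; pose C : finType := 'X_{1..m < B.+1}.
pose gX (a : A) := \prod_i tnth g i ^+ a i.
pose M := \matrix_(a < #|A|, b < #|C|) (gX (enum_val a))@_(enum_val b : C).
have lt_CA : (#|C| < #|A|)%N.
  apply: leq_ltn_trans (card_bounded_monomials m B) _.
  rewrite card_ffun !card_ord.
  apply: leq_trans (leq_pexp2l (isT : 0 < D)%N lt_mn).
  apply: (@leq_ltn_trans (D ^ m * (n * e).+1 ^ m)%N).
    rewrite -expnMn; case: (m) => [//|m']; rewrite leq_exp2r //.
    by rewrite mulnS -addn1 addnC leq_add2r.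
  by rewrite expnSr ltn_mul2l expn_gt0 ltnSn.
have : kermx M != 0.
  rewrite -mxrank_eq0 mxrank_ker subn_eq0 -ltnNge.
  exact: leq_ltn_trans (rank_leq_col M) lt_CA.
case/rowV0Pn => u /sub_kermxP uM nz_u.
pose q := \sum_(a < #|A|) u 0 a *: 'X_[[multinom (enum_val a : A) i : nat | i < n]].
have q_g : q \mPo g = \sum_(a < #|A|) u 0 a *: gX (enum_val a).
  rewrite linear_sum; apply: eq_bigr => a _; rewrite linearZ /= comp_mpolyX.
  by congr (_ *: _); apply: eq_bigr => i _; rewrite mnmE.
have sz_gX (a : A) : (msize (gX a) <= B.+1)%N.
  have -> : B = (\sum_(i < n) D * e)%N by rewrite sum_nat_const card_ord mulnCA.
  rewrite /gX; elim/big_rec2: _ => [|i y p _ IHp]; first by rewrite msize1.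
  apply: msize_mul_le IHp.
  have: (a i <= D)%N by apply: ltnW.
  have le_e : (msize (tnth g i) <= e.+1)%N by apply/leqW; apply: leq_bigmax.
  move: (nat_of_ord (a i)) => d le_d.
  apply: (@leq_trans (d * e).+1); last by rewrite ltnS leq_mul2r le_d orbT.
  elim: {le_d} d => [|d IHd]; first by rewrite msize1.
  by rewrite exprS mulSn; apply: msize_mul_le.
have q0 : q = 0.
  apply: ind_g; rewrite q_g; apply/mpolyP => b; rewrite mcoeff0 raddf_sum /=.
  have [lt_b|le_b] := ltnP (mdeg b) B.+1.
    transitivity ((u *m M) 0 (enum_rank (BMultinom lt_b))); last by rewrite uM mxE.
    by rewrite mxE; apply: eq_bigr => a _; rewrite mcoeffZ mxE enum_rankK.
  rewrite big1 // => a _; rewrite mcoeffZ [_@__]memN_msupp_eq0 ?mulr0 //.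
  by apply: msize_mdeg_ge; apply: leq_trans le_b.
case/eqP: nz_u; apply/rowP => a; rewrite mxE.
have /mpolyP/(_ [multinom (enum_val a : A) i : nat | i < n]) := q0.
rewrite mcoeff0 raddf_sum (bigD1 a) //= mcoeffZ mcoeffX eqxx mulr1.
rewrite big1 ?addr0 // => b ne_ba; rewrite mcoeffZ mcoeffX.
case: eqP => [/mnmP eq_ab|]; last by rewrite mulr0.
case/eqP: ne_ba; apply: enum_val_inj; apply/ffunP => i.
by apply: val_inj; have:= eq_ab i; rewrite !mnmE.
Qed.

Lemma msize_mderiv n (q : {mpoly F[n]}) i : q != 0 -> (msize q^`M(i) < msize q)%N.
Proof.
move=> nz_q; have sz_gt0 : (0 < msize q)%N by rewrite lt0n msize_poly_eq0.
rewrite -(prednK sz_gt0) ltnS [msize _^`M(i)]msizeE; apply/bigmax_leqP_seq => m.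
rewrite mcoeff_msupp mcoeff_mderiv => nz_m _.
have: (m + U_(i))%MM \in msupp q.
  by rewrite mcoeff_msupp; apply: contra_neq nz_m => ->; rewrite mul0rn.
by move/msize_mdeg_lt; rewrite mdegD mdeg1 addn1 -{1}(prednK sz_gt0).
Qed.

Lemma mulrSn_eq0 (x : F) k : x *+ k.+1 = 0 -> x = 0.
Proof.
by move/eqP; rewrite -mulr_natr mulf_eq0 ((pcharf0P F).1 charF0) orbF => /eqP.
Qed.

Lemma mderiv0_coeff n (q : {mpoly F[n]}) i (m : 'X_{1..n}) :
  q^`M(i) = 0 -> (0 < m i)%N -> q@_m = 0.
Proof.
move=> /mpolyP/(_ (m - U_(i))%MM); rewrite mcoeff_mderiv mcoeff0 => q0 m_gt0.
have le_m : (U_(i) <= m)%MM.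
  by apply/mnm_lepP => k; rewrite mnm1E; case: eqP => // <-.
by move: q0; rewrite submK // => /mulrSn_eq0.
Qed.

Lemma mderiv0_const n (q : {mpoly F[n]}) : (forall i, q^`M(i) = 0) -> q = (q@_0)%:MP.
Proof.
move=> dq0; apply/mpolyP => m; rewrite mcoeffC.
have [->|nz_m] := eqVneq m 0%MM; first by rewrite mulr1.
rewrite mulr0.
have [i m_gt0] : exists i, (0 < m i)%N.
  apply/existsP; apply: contraNT nz_m; rewrite negb_exists => /forallP m0.
  by apply/eqP/mnmP => i; rewrite mnm0E; apply/eqP; rewrite -leqn0 leqNgt.
exact: mderiv0_coeff (dq0 i) m_gt0.
Qed.

(** Differentiating a relation of minimal degree among the g_i gives a linear
    relation among the gradients, with coefficients that are not relations. *)
Lemma jacobian_alg_indep n m (g : n.-tuple {mpoly F[m]}) v :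
  row_free (jacobian g v) -> alg_indep g.
Proof.
case/row_freeP => R JR q.
pose J : 'M[{mpoly F[m]}]_(n, m) := \matrix_(i, j) (tnth g i)^`M(j).
pose D := J *m map_mx (@mpolyC m F) R.
have nz_D : \det D != 0.
  suff: (\det D).@[v] = 1.
    by move=> detv; apply/eqP => D0; move/eqP: detv; rewrite D0 meval0 eq_sym oner_eq0.
  rewrite -det_map_mx -[RHS](det1 _ n) -JR map_mxM; congr (\det (_ *m _)).
    by apply/matrixP => i j; rewrite !mxE.
  by apply/matrixP => i j; rewrite !mxE /= mevalC.
have [k] := ubnP (msize q); elim: k q => // k IHk q /ltnSE le_qk qg0.
apply/eqP; apply: contraT => nz_q.
pose u : 'rV[{mpoly F[m]}]_n := \row_i (q^`M(i) \mPo g).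
have uJ : u *m J = 0.
  apply/rowP => j; rewrite !mxE; transitivity (q \mPo g)^`M(j).
    by rewrite mderiv_comp; apply: eq_bigr => i _; rewrite !mxE.
  by rewrite qg0 mderiv0.
have u0 : u = 0.
  have: \det D *: u = 0.
    by rewrite -mul_mx_scalar -mul_mx_adj /D !mulmxA uJ !mul0mx.
  by move/eqP; rewrite scalemx_eq0 (negPf nz_D) => /eqP.
have dq0 i : q^`M(i) = 0.
  apply: IHk; first exact: leq_trans (msize_mderiv i nz_q) le_qk.
  by have /rowP/(_ i) := u0; rewrite !mxE.
move: qg0 nz_q; rewrite (mderiv0_const dq0) comp_mpolyC => /eqP.
by rewrite mpolyC_eq0 => /eqP->; rewrite mpolyC0 eqxx.
Qed.

(** If a derivative of a relation is again a nonzero relation, it has smaller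
    degree; so the descent stops. *)
Lemma minimal_relation n m (g : n.-tuple {mpoly F[m]}) : ~ alg_indep g ->
  exists q, [/\ q != 0, q \mPo g = 0
             & forall i, q^`M(i) \mPo g = 0 -> q^`M(i) = 0].
Proof.
move=> dep_g; have [q dep_q] := not_all_ex_not _ _ dep_g.
have [qg0 /eqP nz_q] := imply_to_and _ _ dep_q.
have [k] := ubnP (msize q); elim: k q nz_q qg0 {dep_q} => // k IHk q nz_q qg0 /ltnSE le_qk.
have [[i]|dq] := classic (exists i, q^`M(i) \mPo g = 0 /\ q^`M(i) != 0).
  move=> [dqg0 nz_dq]; apply: (IHk q^`M(i)) => //.
  exact: leq_trans (msize_mderiv i nz_q) le_qk.
exists q; split=> // i dqg0; apply/eqP; apply: contraT => nz_dq.
by case: dq; exists i.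
Qed.

Lemma tnth_rcons_widen (T : Type) n (t : n.-tuple T) x (i : 'I_n) :
  tnth [tuple of rcons t x] (widen_ord (leqnSn n) i) = tnth t i.
Proof. by rewrite !(tnth_nth x) /= nth_rcons size_tuple ltn_ord. Qed.

Lemma tnth_rcons_max (T : Type) n (t : n.-tuple T) x :
  tnth [tuple of rcons t x] ord_max = x.
Proof. by rewrite (tnth_nth x) /= nth_rcons size_tuple ltnn eqxx. Qed.

Lemma ord_widen_or_max n (P : 'I_n.+1 -> Prop) :
  (forall i, P (widen_ord (leqnSn n) i)) -> P ord_max -> forall i, P i.
Proof.
move=> Pw Pm i; case: (unliftP ord_max i) => [j ->|-> //].
by have -> : lift ord_max j = widen_ord (leqnSn n) j
  by apply: val_inj; rewrite /= /bump leqNgt ltn_ord.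
Qed.

(** In characteristic zero the last variable cannot occur in q; stated through
    substitutions because the other variables form a different ring. *)
Lemma mderiv_last0 n (q : {mpoly F[n.+1]}) : q^`M(ord_max) = 0 ->
  exists q' : {mpoly F[n]}, forall m (g : n.-tuple {mpoly F[m]}) x,
    q \mPo [tuple of rcons g x] = q' \mPo g.
Proof.
move=> dq0; exists (q \mPo [tuple of rcons [tuple 'X_i | i < n] 0]) => m g x.
rewrite !(comp_mpolyE q) linear_sum /= !big_seq; apply: eq_bigr => d d_q.
have d0 : d ord_max = 0%N.
  apply/eqP; rewrite -leqn0 leqNgt; apply: contraTN d_q => /(mderiv0_coeff dq0).
  by rewrite mcoeff_msupp => ->; rewrite eqxx.
rewrite linearZ /= !big_ord_recr /= d0 !expr0 !mulr1 rmorph_prod; congr (_ *: _).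
by apply: eq_bigr => i _; rewrite rmorphXn /= !tnth_rcons_widen tnth_mktuple comp_mpolyXU -tnth_nth.
Qed.

(** A relation between g and x has to involve x, since g alone satisfies none. *)
Lemma alg_indep_dep_last n m (g : n.-tuple {mpoly F[m]}) x (q : {mpoly F[n.+1]}) :
    alg_indep g -> q != 0 -> q \mPo [tuple of rcons g x] = 0 ->
  q^`M(ord_max) != 0.
Proof.
move=> ind_g nz_q qgx; apply: contraNneq nz_q => /mderiv_last0[q' Eq'].
move: qgx; rewrite Eq' => /ind_g q'0; rewrite -[q]comp_mpoly_id.
have -> : [tuple 'X_i | i < n.+1] = [tuple of rcons [tuple ('X_(widen_ord (leqnSn n) i)
    : {mpoly F[n.+1]}) | i < n] 'X_ord_max].
  apply: eq_from_tnth; apply: ord_widen_or_max => [i|].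
    by rewrite tnth_rcons_widen !tnth_mktuple.
  by rewrite tnth_rcons_max tnth_mktuple.
by rewrite Eq' q'0 rmorph0.
Qed.

(** Converse of the criterion. As long as some variable X_j keeps the
    family independent, adjoin it: deleting its gradient again lowers the
    rank by at most one. Once no variable does, differentiating the relation
    that X_j satisfies puts the j-th unit vector in the span of the gradients. *)
Lemma alg_indep_jacobian n m (g : n.-tuple {mpoly F[m]}) (h : {mpoly F[m]}) :
  alg_indep g -> h != 0 -> exists v, h.@[v] != 0 /\ row_free (jacobian g v).
Proof.
have [k] := ubnP (m - n); elim: k n g => // k IHk n g /ltnSE le_k ind_g nz_h.
have le_nm := alg_indep_leq ind_g.
have [[j ind_gX]|dep] := classic (exists j : 'I_m, alg_indep [tuple of rcons g 'X_j]).
  have lt_nm := alg_indep_leq ind_gX.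
  have [|v [nz_hv free_v]] := IHk _ _ _ ind_gX nz_h.
    by apply: leq_trans le_k; rewrite ltn_sub2l.
  exists v; split=> //; rewrite /row_free eqn_leq rank_leq_row.
  have: (jacobian [tuple of rcons g 'X_j] v <= jacobian g v + delta_mx (0 : 'I_1) j)%MS.
    apply/row_subP; apply: ord_widen_or_max => [i|].
      apply: submx_trans (addsmxSl _ _); apply: (eq_row_sub i).
      by apply/rowP => l; rewrite !mxE tnth_rcons_widen.
    apply: submx_trans (addsmxSr _ _); apply: (eq_row_sub 0).
    apply/rowP => l; rewrite !mxE tnth_rcons_max.
    by rewrite mderivXU -mpolyC_nat mevalC eq_sym.
  move/mxrankS; rewrite (eqP free_v) => /leq_trans/(_ (mxrank_adds_leqif _ _).1).
  by rewrite mxrank_delta addn1.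
have rel j : exists q : {mpoly F[n.+1]}, q \mPo [tuple of rcons g 'X_j] = 0 /\
    q^`M(ord_max) \mPo [tuple of rcons g 'X_j] != 0.
  have [q [nz_q qg0 dq]] := minimal_relation (fun ind => dep (ex_intro _ j ind)).
  exists q; split=> //; apply/eqP => /dq/eqP.
  by apply/negP; apply: alg_indep_dep_last qg0.
have [q Eq] := fin_all_exists rel.
pose c j := (q j)^`M(ord_max) \mPo [tuple of rcons g 'X_j].
have /mpoly_nonroot[v] : h * \prod_j c j != 0.
  by rewrite mulf_neq0 //; apply/prodf_neq0 => j _; case: (Eq j).
rewrite mevalM mulf_eq0 negb_or => /andP[nz_hv]; rewrite rmorph_prod => /prodf_neq0 nz_c.
exists v; split=> //; rewrite /row_free eqn_leq rank_leq_row.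
suff: row_full (jacobian g v) by rewrite /row_full => /eqP->.
rewrite -sub1mx; apply/row_subP => j; rewrite row1.
have [qg0 _] := Eq j; have nz_cj : (c j).@[v] != 0 by apply: nz_c.
pose u := \row_i ((q j)^`M(widen_ord (leqnSn n) i) \mPo [tuple of rcons g 'X_j]).@[v].
suff E : (c j).@[v] *: delta_mx 0 j = - (u *m jacobian g v).
  rewrite -[delta_mx 0 j](scalerK nz_cj) E; apply: scalemx_sub.
  by rewrite -mulNmx submxMl.
apply/rowP => l; rewrite !mxE; apply/eqP; rewrite -addr_eq0 addrC; apply/eqP.
have := congr1 (meval v) (congr1 (mderiv l) qg0).
rewrite mderiv0 meval0 mderiv_comp big_ord_recr mevalD raddf_sum /= => E; rewrite -[RHS]E.
congr (_ + _).
  apply: eq_bigr => i _.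
  by rewrite mevalM !mxE tnth_rcons_widen.
rewrite mevalM tnth_rcons_max mderivXU.
by rewrite eq_sym -mpolyC_nat mevalC.
Qed.
End Polynomials.

(** * The dimension of a parametrized variety *)

Section Parametrization.
Local Open Scope ring_scope.
Variable F : fieldType.
Hypothesis charF0 : [pchar F] =i pred0.

Lemma comp_mpoly_assoc a b c (q : {mpoly F[a]}) (f : a.-tuple {mpoly F[b]})
    (g : b.-tuple {mpoly F[c]}) :
  (q \mPo f) \mPo g = q \mPo [tuple (tnth f i) \mPo g | i < a].
Proof.
rewrite (comp_mpolyEX q f) (comp_mpolyEX q) linear_sum; apply: eq_bigr => d _.
rewrite linearZ !comp_mpolyX rmorph_prod; congr (_ *: _).
by apply: eq_bigr => i _; rewrite rmorphXn tnth_mktuple.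
Qed.

Lemma meval_eq0 n (p : {mpoly F[n]}) :
  (forall v, p.@[v] = 0) -> p = 0.
Proof.
move=> p0; apply/eqP; apply: contraT => /(mpoly_nonroot charF0)[v].
by rewrite p0 eqxx.
Qed.

Lemma meval_homog n (p : {mpoly F[n]}) d (v : 'I_n -> F) t :
  p \is d.-homog -> p.@[fun i => t * v i] = t ^+ d * p.@[v].
Proof.
move/dhomogP => hom_p; rewrite !mevalE big_distrr big_seq [RHS]big_seq /=.
apply: eq_bigr => m /hom_p <-; rewrite mulrCA; congr (_ * _).
rewrite -[X in t ^+ X]/(mdeg m) mdegE expr_sum -big_split /=.
by apply: eq_bigr => i _; rewrite exprMn.
Qed.

(** On a line through the origin p is a polynomial in the parameter t whose
    coefficients are the values of the homogeneous components. *)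
Lemma pihomog_vanishes n (p : {mpoly F[n]}) (v : 'I_n -> F) :
    (forall t, p.@[fun i => t * v i] = 0) ->
  forall d, (pihomog mdeg d p).@[v] = 0.
Proof.
move=> p0 d; have [lt_d|le_d] := ltnP d (msize p); last first.
  rewrite (_ : pihomog mdeg d p = 0) ?meval0 // pihomogE big_seq_cond big_pred0 // => m.
  apply: contraTF le_d => /andP[/msize_mdeg_lt lt_m /eqP <-].
  by rewrite -ltnNge.
pose P : {poly F} := \poly_(e < msize p) (pihomog mdeg e p).@[v].
have P0 : P = 0.
  apply/eqP; apply: contraT => /(poly_nonroot charF0)[t].
  rewrite horner_poly => /eqP; case; rewrite -[RHS](p0 t).
  rewrite [p in RHS](@pihomog_partitionE _ _ mdeg (msize p) p) // raddf_sum /=.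
  by apply: eq_bigr => e _; rewrite (meval_homog _ _ (pihomogP _ _ _)) mulrC.
by have := congr1 (fun Q : {poly F} => Q`_d) P0; rewrite coef_poly lt_d coef0.
Qed.

Section Dimension.
Variables (N m : nat) (X : proj_space F N -> Prop) (phi : N.-tuple {mpoly F[m]}).
Hypothesis vanishing_param : forall p, vanishing_ideal X p <-> p \mPo phi = 0.

Lemma alg_independent_on_param r (f : r.-tuple {mpoly F[N]}) :
  alg_independent_on X f <-> alg_indep [tuple (tnth f i) \mPo phi | i < r].
Proof.
split=> ind q; first by rewrite -comp_mpoly_assoc => /vanishing_param/ind.
by move/vanishing_param; rewrite comp_mpoly_assoc => /ind.
Qed.

Lemma jacobian_comp r (f : r.-tuple {mpoly F[N]}) v :
  jacobian [tuple (tnth f i) \mPo phi | i < r] v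
  = jacobian f (fun x => (tnth phi x).@[v]) *m jacobian phi v.
Proof.
apply/matrixP => i j; rewrite !mxE tnth_mktuple mderiv_comp raddf_sum /=.
by apply: eq_bigr => x _; rewrite mevalM !mxE comp_mpoly_meval.
Qed.

(** The independent functions are linear forms, whose coefficients select a
    basis of the row space of the Jacobian matrix. *)
Lemma alg_independent_of_rank v :
  exists f : (\rank (jacobian phi v)).-tuple {mpoly F[N]}, alg_independent_on X f.
Proof.
set J := jacobian phi v.
have /submxP[L EL] : (row_base J <= J)%MS by rewrite eq_row_base.
exists [tuple \sum_x L i x *: 'X_x | i < \rank J].
apply/alg_independent_on_param; apply: (@jacobian_alg_indep _ charF0 _ _ _ v).
rewrite jacobian_comp -/J.
have -> : jacobian [tuple \sum_x L i x *: 'X_x | i < \rank J]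
    (fun x => (tnth phi x).@[v]) = L.
  apply/matrixP => i x; rewrite !mxE tnth_mktuple (raddf_sum (mderiv x)) (raddf_sum (meval _)) /=.
  rewrite (bigD1 x) //= big1 => [|y ne_yx].
    by rewrite linearZ /= mderivXU eqxx mevalZ meval1 mulr1 addr0.
  by rewrite linearZ /= mderivXU (negPf ne_yx) mevalZ meval0 mulr0.
by rewrite -EL row_base_free.
Qed.

(** By the chain rule the Jacobian matrix of f after phi factors through that
    of phi. *)
Lemma rank_of_alg_independent r (f : r.-tuple {mpoly F[N]}) (h : {mpoly F[m]}) :
    alg_independent_on X f -> h != 0 ->
  exists v, h.@[v] != 0 /\ (r <= \rank (jacobian phi v))%N.
Proof.
move=> /alg_independent_on_param ind nz_h.
have [v [nz_hv]] := alg_indep_jacobian charF0 ind nz_h.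
rewrite jacobian_comp /row_free => /eqP rk; exists v; split=> //.
by rewrite -[leqLHS]rk mxrankM_maxr.
Qed.

Lemma has_dim_of_rank d v0 (h : {mpoly F[m]}) :
    (d < \rank (jacobian phi v0))%N -> h != 0 ->
    (forall v, h.@[v] != 0 -> (\rank (jacobian phi v) <= d.+1)%N) ->
  has_dim X d.
Proof.
move=> lt_d nz_h le_d; have [f ind_f] := alg_independent_of_rank v0; split.
  suff rk : \rank (jacobian phi v0) = d.+1 by move: f ind_f; rewrite rk => f ind_f; exists f.
  apply/eqP; rewrite eqn_leq lt_d andbT.
  have [v [/le_d le_v le_rk]] := rank_of_alg_independent ind_f nz_h.
  exact: leq_trans le_rk le_v.
case=> g /rank_of_alg_independent-/(_ _ nz_h)[v [/le_d le_v le_rk]].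
by have:= leq_trans le_rk le_v; rewrite ltnn.
Qed.

(** For defective varieties an upper bound for the rank suffices: the
    dimension is one less than the largest rank that occurs. *)
Lemma has_dim_lt_of_rank r v0 (h : {mpoly F[m]}) :
    (0 < \rank (jacobian phi v0))%N -> h != 0 ->
    (forall v, h.@[v] != 0 -> (\rank (jacobian phi v) <= r)%N) ->
  exists d, has_dim X d /\ (d < r)%N.
Proof.
move=> rk_gt0 nz_h le_r.
have le_all v : (\rank (jacobian phi v) <= r)%N.
  have [f ind_f] := alg_independent_of_rank v.
  have [v' [/le_r le_v' le_rk]] := rank_of_alg_independent ind_f nz_h.
  exact: leq_trans le_rk le_v'.
have [v rk_max] : exists v, forall v', (\rank (jacobian phi v') <= \rank (jacobian phi v))%N.
  have [k] := ubnP (r - \rank (jacobian phi v0)); elim: k (v0) => // k IHk v.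
  have [[v' lt_v']|no_v] := classic (exists v', \rank (jacobian phi v) < \rank (jacobian phi v'))%N.
    move=> /ltnSE le_k; apply: (IHk v'); apply: leq_trans le_k.
    by rewrite ltn_sub2l // (leq_trans lt_v').
  move=> _; exists v => v'; rewrite leqNgt; apply/negP => lt_v'; apply: no_v.
  by exists v'.
have v_gt0 : (0 < \rank (jacobian phi v))%N by apply: leq_trans (rk_max v0).
exists (\rank (jacobian phi v)).-1; rewrite prednK //; split=> //.
by apply: (@has_dim_of_rank _ v 1); rewrite ?oner_neq0 ?prednK.
Qed.
End Dimension.
End Parametrization.

(** * The parametrization of a secant variety by factors of pure tensors *)

Section SecantMap.
Local Open Scope ring_scope.
Variable F : fieldType.
Hypothesis charF0 : [pchar F] =i pred0.
Variables (s k : nat) (n : k.-tuple nat).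

Local Notation N := #|tensor_index n|.

Definition param : finType := ('I_s * {i : 'I_k & 'I_(tnth n i).+1})%type.
Local Notation m := #|param|.

Definition par (j : 'I_s) (i : 'I_k) (l : 'I_(tnth n i).+1) : 'I_m :=
  enum_rank ((j, Tagged (fun i => 'I_(tnth n i).+1) l) : param).

Definition factor (v : 'I_m -> F) j i : 'rV[F]_(tnth n i).+1 :=
  \row_l v (par j l).

Definition multi_index (x : 'I_N) : tensor_index n := enum_val x.

Definition secant_map : N.-tuple {mpoly F[m]} :=
  [tuple \sum_(j < s) \prod_(i < k) 'X_(par j (multi_index x i)) | x < N].

Lemma secant_map_eval v x :
  (tnth secant_map x).@[v] = (\sum_j pure_tensor (factor v j)) 0 x.
Proof.
rewrite tnth_mktuple raddf_sum summxE; apply: eq_bigr => j _ /=.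
rewrite rmorph_prod mxE; apply: eq_bigr => i _.
by rewrite /= mevalXU mxE.
Qed.

Lemma pure_tensor_ext (u w : forall i : 'I_k, 'rV[F]_(tnth n i).+1) :
  (forall i, u i = w i) -> pure_tensor u = pure_tensor w.
Proof. by move=> eq_uw; apply/rowP => x; rewrite !mxE; apply: eq_bigr => i _; rewrite eq_uw. Qed.

Lemma factor_surj (u : 'I_s -> forall i : 'I_k, 'rV[F]_(tnth n i).+1) :
  exists v, forall j i, factor v j i = u j i.
Proof.
exists (fun p => let q := enum_val p : param in u q.1 (tag q.2) 0 (tagged q.2)) => j i.
by apply/rowP => l; rewrite mxE enum_rankK.
Qed.

Lemma pure_tensor_scale c (i0 : 'I_k) (u : forall i : 'I_k, 'rV[F]_(tnth n i).+1) :
  pure_tensor (fun i => (if i == i0 then c else 1) *: u i) = c *: pure_tensor u.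
Proof.
apply/rowP => x; rewrite !mxE; under eq_bigr do rewrite mxE.
rewrite big_split /= (bigD1 i0) //= eqxx big1 ?mulr1 // => i.
by move/negPf->.
Qed.

Lemma pure_tensor0 (u : forall i : 'I_k, 'rV[F]_(tnth n i).+1) i0 :
  u i0 = 0 -> pure_tensor u = 0.
Proof.
by move=> u0; apply/rowP => x; rewrite !mxE (bigD1 i0) //= u0 mxE mul0r.
Qed.

Lemma dim_line (x : 'rV[F]_N) : x != 0 -> \dim <[x]>%VS == 1.
Proof. by move=> nz_x; rewrite dim_vline nz_x. Qed.

Lemma pure_tensor_neq0 (u : forall i : 'I_k, 'rV[F]_(tnth n i).+1) :
  (forall i, u i != 0) -> pure_tensor u != 0.
Proof.
move=> nz_u; have ex i : exists l, u i 0 l != 0 by apply/rV0Pn.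
have [l nz_l] := fin_all_exists ex.
apply/rV0Pn; exists (enum_rank ([ffun i => l i] : tensor_index n)).
rewrite mxE enum_rankK; apply/prodf_neq0 => i _; by rewrite ffunE.
Qed.

(** The closure does not matter: the homogeneous components of a polynomial
    that vanishes on all sums of s pure tensors also vanish there, so they
    define a closed set that contains the secant variety. *)
Lemma secant_vanishing (i0 : 'I_k) (j0 : 'I_s) (p : {mpoly F[N]}) :
  vanishing_ideal (secant_variety s (@segre F k n)) p <-> p \mPo secant_map = 0.
Proof.
pose S (L : proj_space F N) := exists P : s.-tuple (proj_space F N),
  (forall i, segre (tnth P i)) /\ (val L <= \sum_(i < s) val (tnth P i))%VS.
split=> [van_p | p0].
  apply: (meval_eq0 charF0) => v; rewrite comp_mpoly_meval.
  set y := \sum_j pure_tensor (factor v j).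
  have -> : p.@[fun x => (tnth secant_map x).@[v]] = p.@[y 0].
    by apply: meval_eq => x; apply: secant_map_eval.
  pose one i : 'rV[F]_(tnth n i).+1 := const_mx 1.
  have nz_one i : one i != 0.
    by apply/rV0Pn; exists 0; rewrite mxE oner_neq0.
  (* A zero factor is allowed in the parameter space, but not in a point of the
     Segre variety: such a summand is replaced by the tensor of all-ones
     vectors, which then enters with coefficient zero. *)
  pose u j i := if [forall i', factor v j i' != 0] then factor v j i else one i.
  have nz_u j i : u j i != 0 by rewrite /u; case: forallP.
  pose line x nz_x : proj_space F N := exist _ <[x]>%VS (dim_line nz_x).
  pose P := [tuple line _ (pure_tensor_neq0 (nz_u j)) | j < s].
  have segP j : segre (tnth P j).
    by exists (u j); split=> //; rewrite tnth_mktuple.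
  have y_in : y \in (\sum_(i < s) val (tnth P i))%VS.
    apply: memv_sumr => j _; rewrite tnth_mktuple /=.
    have [all_nz|/forallPn[i /negPn/eqP f0]] := boolP [forall i', factor v j i' != 0].
      rewrite (_ : pure_tensor (factor v j) = pure_tensor (u j)) ?memv_line //.
      by apply: pure_tensor_ext => i; rewrite /u all_nz.
    by rewrite (pure_tensor0 f0) mem0v.
  have inS L : S L -> secant_variety s (@segre F k n) L.
    by move=> S_L Z _; apply.
  have [y0|nz_y] := eqVneq y 0.
    apply: (van_p (tnth P j0)); last by rewrite y0 mem0v.
    apply: inS; exists P; split=> //.
    by rewrite (bigD1 j0) //= addvSl.
  apply: (van_p (line _ nz_y)); last exact: memv_line.
  apply: inS; exists P; split=> //.
have van_S L x : S L -> x \in val L -> p.@[x 0] = 0.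
  case=> P [segP /subvP leL] /leL/memv_sumP[y y_in ->].
  have ex j : exists u, y j = pure_tensor u.
    have [u [_ Pj]] := segP j; have := y_in j isT; rewrite Pj => /vlineP[c ->].
    (* The coefficient is absorbed by one factor, so k must be positive. *)
    by eexists; rewrite -(pure_tensor_scale c i0).
  have [u yu] := fin_all_exists ex; have [v fv] := factor_surj u.
  have := congr1 (meval v) p0; rewrite meval0 comp_mpoly_meval => <-.
  apply: meval_eq => x'; rewrite secant_map_eval; congr (fun_of_matrix _ _ _).
  by apply: eq_bigr => j _; rewrite yu; apply: pure_tensor_ext => i; rewrite fv.
have van_hom L d : S L -> vanishes_at (pihomog mdeg d p) L.
  move=> S_L x Lx; apply: (pihomog_vanishes charF0) => t.
  rewrite -(van_S L (t *: x)) ?memvZ //.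
  by apply: meval_eq => i; rewrite mxE.
move=> L sec_L x Lx.
have {sec_L} van_L : forall d, vanishes_at (pihomog mdeg d p) L.
  apply: (sec_L (fun L => forall d, vanishes_at (pihomog mdeg d p) L)).
    exists (fun q => exists d, q = pihomog mdeg d p); split=> [q [d ->]|M].
      by exists d; apply: pihomogP.
    by split=> [van q [d ->] //|van d]; apply: van; exists d.
  by move=> M S_M d; apply: van_hom.
rewrite [p](pihomog_partitionE (leqnn (mmeasure mdeg p))) raddf_sum big1 //= => d _.
exact: van_L.
Qed.
End SecantMap.

(** * Tangent directions *)

Section Tangent.
Local Open Scope ring_scope.
Variable F : fieldType.
Variables (s k : nat) (n : k.-tuple nat).
Local Notation N := #|tensor_index n|.
Local Notation m := #|param s n|.

Lemma big_param (f : 'I_m -> F) :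
  \sum_p f p = \sum_j \sum_i \sum_l f (@par s k n j i l).
Proof.
rewrite (reindex enum_rank) /=; last exact/onW_bij/enum_rank_bij.
transitivity (\sum_j \sum_(q : {i : 'I_k & 'I_(tnth n i).+1})
    f (enum_rank ((j, q) : param s n))).
  by rewrite pair_bigA; apply: eq_bigr => -[j q].
apply: eq_bigr => j _.
by rewrite sig_big_dep; apply: eq_bigr => -[i l].
Qed.

Lemma par_inj (j j' : 'I_s) (i i' : 'I_k) (l : 'I_(tnth n i).+1) (l' : 'I_(tnth n i').+1) :
  (@par s k n j i l == @par s k n j' i' l')
  = [&& j == j', i == i' & l == l' :> nat].
Proof.
rewrite (inj_eq enum_rank_inj) -pair_eqE /=; congr (_ && _).
rewrite -tag_eqE /tag_eq /=; case: eqP => // eq_i; subst i'.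
by rewrite tagged_asE.
Qed.

Lemma mderiv_prod_vars (p : 'I_m) (I : finType) (P : pred I) (f : I -> 'I_m) :
  (forall i, P i -> f i != p) ->
  (\prod_(i | P i) 'X_(f i) : {mpoly F[m]})^`M(p) = 0.
Proof.
move=> ne_p; elim/big_rec: _ => [|i q Pi IHq]; first by rewrite -mpolyC1 mderivC.
by rewrite mderivM IHq mderivXU (negPf (ne_p i Pi)) mul0r mulr0 addr0.
Qed.

Lemma jacobian_secant_map v x (j : 'I_s) (i : 'I_k) (l : 'I_(tnth n i).+1) :
  (jacobian (secant_map F s n) v) x (@par s k n j i l)
  = (multi_index x i == l)%:R
    * \prod_(i' < k | i' != i) v (@par s k n j i' (multi_index x i')).
Proof.
rewrite mxE tnth_mktuple (raddf_sum (mderiv _)) (bigD1 j) //= [X in _ + X]big1 ?addr0.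
  rewrite [\prod_(i' < k) 'X_ _](bigD1 i) //= mderivM mderiv_prod_vars ?mulr0 ?addr0 => [|i' ne_i].
    rewrite mevalM rmorph_prod mderivXU par_inj !eqxx /= -mpolyC_nat mevalC.
    by congr (_ * _); apply: eq_bigr => i' _; rewrite mevalXU.
  by rewrite par_inj (negPf ne_i) andbF.
move=> j' ne_j; apply: mderiv_prod_vars => i' _.
by rewrite par_inj (negPf ne_j).
Qed.

Lemma mul_jacobian_secant_map (c : 'rV[F]_m) v x :
  (c *m (jacobian (secant_map F s n) v)^T) 0 x
  = \sum_j \sum_i c 0 (@par s k n j i (multi_index x i))
    * \prod_(i' < k | i' != i) v (@par s k n j i' (multi_index x i')).
Proof.
rewrite mxE big_param; apply: eq_bigr => j _; apply: eq_bigr => i _.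
rewrite (bigD1 (multi_index x i)) //= big1 => [|l ne_l].
  by rewrite mxE jacobian_secant_map eqxx mul1r addr0.
by rewrite mxE jacobian_secant_map eq_sym (negPf ne_l) mul0r mulr0.
Qed.

(** Rescaling the factors of a pure tensor against each other does not change
    it. So, where initial coordinates do not vanish, the initial coordinate
    of every factor but the first may be kept fixed without losing tangent
    directions. *)
Definition normalized : pred (param s n) :=
  fun q => (tag q.2 == 0%N :> nat) || (tagged q.2 != 0%N :> nat).

Lemma card_normalized : (0 < k)%N ->
  #|normalized| = (s * (\sum_(i < k) tnth n i).+1)%N.
Proof.
move=> k_gt0; rewrite -sum1_card.
transitivity (\sum_(j < s) \sum_(i < k)
    \sum_(l < (tnth n i).+1 | (i == 0%N :> nat) || (l != 0%N :> nat)) 1)%N.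
  rewrite (@sig_big_dep _ _ addn _ (fun i => 'I_(tnth n i).+1) xpredT
    (fun i l => (i == 0%N :> nat) || (l != 0%N :> nat)) (fun _ _ => 1%N)).
  rewrite pair_big_dep /=.
  by apply: eq_bigl => -[j [i l]].
rewrite sum_nat_const card_ord; congr (_ * _)%N.
pose i0 := Ordinal k_gt0; rewrite [LHS](bigD1 i0) // [in RHS](bigD1 i0) //= -addSn.
congr (_ + _)%N; first by rewrite sum1_card card_ord.
apply: eq_bigr => i; rewrite -val_eqE /= => /negPf ->.
rewrite big_mkcond big_ord_recl /= add0n.
by under eq_bigr do rewrite /=; rewrite sum1_card card_ord.
Qed.

Lemma rank_ge_normalized v :
    (forall c : 'rV[F]_m, (forall q, ~~ normalized q -> c 0 (enum_rank q) = 0) ->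
      c *m (jacobian (secant_map F s n) v)^T = 0 -> c = 0) ->
  (#|normalized| <= \rank (jacobian (secant_map F s n) v))%N.
Proof.
set J := jacobian _ v => inj_J.
pose f (a : 'I_#|normalized|) := enum_rank (enum_val a : param s n).
have inj_f : injective f by move=> a b /enum_rank_inj/enum_val_inj.
suff: row_free (rowsub f J^T).
  by move/eqP <-; rewrite rowsubE -(mxrank_tr J) mxrankM_maxr.
apply: inj_row_free => u; rewrite rowsubE mulmxA => uJ.
have E p : (u *m rowsub f 1%:M) 0 p = \sum_a u 0 a * (f a == p)%:R.
  by rewrite mxE; apply: eq_bigr => a _; rewrite !mxE.
have /rowP c0 : u *m rowsub f 1%:M = 0.
  apply: inj_J => // q nq; rewrite E big1 // => a _.
  rewrite (inj_eq enum_rank_inj); case: eqP => [eq_q|]; last by rewrite mulr0.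
  by case/negP: nq; rewrite -eq_q; apply: (enum_valP a).
apply/rowP => a; have := c0 (f a); rewrite E [RHS]mxE (bigD1 a) //= eqxx mulr1.
rewrite big1 ?addr0 => [->|b ne_ba]; first by rewrite mxE.
by rewrite (inj_eq inj_f) (negPf ne_ba) mulr0.
Qed.
End Tangent.

(** * Linear independence modulo a prime and in characteristic zero *)

Section ModularElimination.
Local Open Scope ring_scope.
Variables (p : N.t) (K : fieldType).
Hypothesis charK : N.to_nat p \in [pchar K].

Definition eliminate (x : nat) (r0 r : seq N.t) : seq N.t :=
  let b := N.modulo (nth N.zero r x) p in
  if N.eqb b N.zero then r else
  [seq N.modulo (N.add (N.mul (nth N.zero r0 x) z.1) (N.mul (N.sub p b) z.2)) p
    | z <- zip r r0].

(** Gaussian elimination modulo p. Rows are combined by cross-multiplication,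
    which avoids inverses. The fuel is there because the recursive call is on
    a mapped list; the number of rows is enough. *)
Fixpoint rows_independent (fuel : nat) (rows : seq (seq N.t)) : bool :=
  match fuel, rows with
  | _, [::] => true
  | fuel'.+1, r0 :: rows' =>
      let x := find (fun a => ~~ N.eqb (N.modulo a p) N.zero) r0 in
      (x < size r0)%N && rows_independent fuel' [seq eliminate x r0 r | r <- rows']
  | _, _ => false
  end.

Definition residue (a : N.t) : K := (N.to_nat a)%:R.

Lemma residueD a b : residue (N.add a b) = residue a + residue b.
Proof. by rewrite /residue Nnat.N2Nat.inj_add plusE natrD. Qed.

Lemma residueM a b : residue (N.mul a b) = residue a * residue b.
Proof. by rewrite /residue Nnat.N2Nat.inj_mul multE natrM. Qed.

Lemma residue_p : residue p = 0.
Proof. exact: pcharf0 charK. Qed.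

Lemma p_neq0 : p <> N.zero.
Proof. by move=> p0; have:= pcharf_prime charK; rewrite p0. Qed.

Lemma residue_mod a : residue (N.modulo a p) = residue a.
Proof.
by rewrite [in RHS](N.div_mod' a p) residueD residueM residue_p mul0r add0r.
Qed.

Lemma residue_opp_mod a : residue (N.sub p (N.modulo a p)) = - residue a.
Proof.
apply/eqP; rewrite -addr_eq0 -(residue_mod a) -residueD N.sub_add ?residue_p //.
exact/N.lt_le_incl/N.mod_lt/p_neq0.
Qed.

Lemma residue_neq0 a : ~~ N.eqb (N.modulo a p) N.zero -> residue a != 0.
Proof.
apply: contraNN; rewrite -residue_mod /residue -(dvdn_pcharf charK) => dvd_p.
have lt_p := N.mod_lt a p p_neq0; apply/N.eqb_eq.
have [//|a_gt0] := N.eq_0_gt_0_cases (N.modulo a p).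
have := dvdn_leq _ dvd_p; rewrite leqNgt => /(_ _)/negP H; exfalso; apply: H.
  by move: a_gt0; lia.
by move: lt_p; lia.
Qed.

Lemma residue_eq0 a : N.eqb (N.modulo a p) N.zero -> residue a = 0.
Proof. by move/N.eqb_eq => a0; rewrite -residue_mod a0. Qed.

Lemma eliminate_size x r0 r w :
  size r0 = w -> size r = w -> size (eliminate x r0 r) = w.
Proof.
move=> sz0 sz; rewrite /eliminate; case: ifP => // _.
by rewrite size_map size_zip sz sz0 minnn.
Qed.

Lemma residue_eliminate x r0 r w :
    size r0 = w -> size r = w -> residue (nth N.zero r0 x) != 0 ->
  exists a b, a != 0 /\ forall y, (y < w)%N ->
    residue (nth N.zero (eliminate x r0 r) y)
    = a * residue (nth N.zero r y) + b * residue (nth N.zero r0 y).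
Proof.
move=> sz0 sz nz; rewrite /eliminate; case: ifP => _.
  by exists 1, 0; split=> [|y _]; rewrite ?oner_neq0 // mul1r mul0r addr0.
exists (residue (nth N.zero r0 x)), (- residue (nth N.zero r x)); split=> // y lt_y.
rewrite (nth_map (N.zero, N.zero)) ?size_zip ?sz ?sz0 ?minnn // nth_zip ?sz //=.
by rewrite residue_mod residueD !residueM residue_opp_mod.
Qed.

Lemma residue_eliminate_pivot x r0 r w : size r0 = w -> size r = w -> (x < w)%N ->
  residue (nth N.zero (eliminate x r0 r) x) = 0.
Proof.
move=> sz0 sz lt_x; rewrite /eliminate; case: ifP => [/residue_eq0 //|_].
rewrite (nth_map (N.zero, N.zero)) ?size_zip ?sz ?sz0 ?minnn // nth_zip ?sz //=.
by rewrite residue_mod residueD !residueM residue_opp_mod mulNr mulrC subrr.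
Qed.

(** Dividing the coefficients c of a relation between the rows by the factors
    used in the elimination turns it into a relation between the reduced
    rows, up to a multiple of the pivot row. The pivot column shows that this
    multiple is zero. *)
Lemma rows_independentP fuel rows w (c : nat -> K) :
    all (fun r => size r == w) rows -> rows_independent fuel rows ->
    (forall y, (y < w)%N ->
      \sum_(i < size rows) c i * residue (nth N.zero (nth [::] rows i) y) = 0) ->
  forall i, (i < size rows)%N -> c i = 0.
Proof.
elim: fuel rows c => [|fuel IHf] [|r0 rows] c //= /andP[/eqP sz0 /allP sz].
set x := find _ r0 => /andP[lt_x ind] cR.
have nz_x : residue (nth N.zero r0 x) != 0.
  by move: lt_x; rewrite -has_find => /(nth_find N.zero)/residue_neq0.
rewrite sz0 in lt_x.
have szi (i : 'I_(size rows)) : size (nth [::] rows i) = w.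
  by apply/eqP/sz/mem_nth.
have ex (i : 'I_(size rows)) := residue_eliminate sz0 (szi i) nz_x.
have [a] := fin_all_exists ex; case/fin_all_exists => b Eab.
have cR' y : (y < w)%N -> c 0%N * residue (nth N.zero r0 y)
    + \sum_(i < size rows) c i.+1 * residue (nth N.zero (nth [::] rows i) y) = 0.
  by move=> lt_y; have := cR y lt_y; rewrite big_ord_recl.
pose c' i := if insub i is Some i' then c i.+1 / a i' else 0.
have c'E (i : 'I_(size rows)) : c' i = c i.+1 / a i by rewrite /c' valK.
pose t := \sum_(i < size rows) c' i * b i - c 0%N.
have E y : (y < w)%N ->
    \sum_(i < size rows) c' i * residue (nth N.zero (eliminate x r0 (nth [::] rows i)) y)
    = t * residue (nth N.zero r0 y).
  move=> lt_y; rewrite mulrBl; apply/eqP; rewrite eq_sym subr_eq -[X in _ == X]addrC.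
  rewrite -[X in _ == X]subr0 -[X in _ - X](cR' y lt_y) opprD addrACA subrr add0r.
  apply/eqP; rewrite mulr_suml -sumrB; apply: eq_bigr => i _.
  have [nz_a ->] // := Eab i; rewrite mulrDr mulrA c'E divfK //.
  by rewrite addrAC subrr add0r mulrA.
have t0 : t = 0.
  have := E x lt_x; rewrite big1 => [/esym/eqP|i _].
    by rewrite mulf_eq0 (negPf nz_x) orbF => /eqP.
  by rewrite (residue_eliminate_pivot sz0 (szi i)) ?mulr0.
have c'0 i : (i < size rows)%N -> c' i = 0.
  rewrite -(size_map (eliminate x r0)); move: i; apply: (IHf _ _ _ ind).
    by apply/allP => _ /mapP[r /sz/eqP sz_r ->]; rewrite (eliminate_size _ sz0 sz_r).
  move=> y lt_y; rewrite size_map; transitivity (t * residue (nth N.zero r0 y)).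
    by rewrite -E //; apply: eq_bigr => i' _; rewrite (nth_map [::]).
  by rewrite t0 mul0r.
have cS0 i : (i < size rows)%N -> c i.+1 = 0.
  move=> lt_i; have := c'0 i lt_i; rewrite (c'E (Ordinal lt_i)) => /eqP.
  have [nz_a _] := Eab (Ordinal lt_i).
  by rewrite mulf_eq0 invr_eq0 (negPf nz_a) orbF => /eqP.
case=> [_|i]; last by rewrite ltnS; apply: cS0.
have /eqP := cR' x lt_x; rewrite big1 => [|i _]; last by rewrite cS0 ?mul0r.
by rewrite addr0 mulf_eq0 (negPf nz_x) orbF => /eqP.
Qed.
End ModularElimination.

Section CharacteristicZero.
Local Open Scope ring_scope.
Variable F : fieldType.
Hypothesis charF0 : [pchar F] =i pred0.

Lemma intr_neq0 (z : int) : z != 0 -> z%:~R != 0 :> F.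
Proof.
have nat_neq0 k : k.+1%:R != 0 :> F by rewrite ((pcharf0P F).1 charF0).
by case: z => [[|k]|k] //= _; rewrite ?NegzE ?mulrNz ?oppr_eq0 -?pmulrn.
Qed.

(** A right inverse modulo p, lifted to the integers, is a right inverse up to
    a matrix whose determinant is 1 modulo p, hence nonzero. *)
Lemma row_free_mod p r w (M : 'I_r -> 'I_w -> nat) : prime p ->
  row_free (\matrix_(i, x) (M i x)%:R : 'M['F_p]_(r, w)) ->
  row_free (\matrix_(i, x) (M i x)%:R : 'M[F]_(r, w)).
Proof.
move=> pr_p /row_freeP[R MR].
pose A : 'M[int]_(r, w) := \matrix_(i, x) (M i x)%:Z.
pose B : 'M[int]_(w, r) := \matrix_(x, i) (R x i : nat)%:Z.
have detAB : \det (A *m B) != 0.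
  suff : (\det (A *m B))%:~R = 1 :> 'F_p.
    by apply: contra_eqN => /eqP ->; rewrite eq_sym oner_eq0.
  rewrite -det_map_mx -[RHS](det1 _ r) -MR map_mxM; congr (\det (_ *m _)).
    by apply/matrixP => i j; rewrite !mxE.
  by apply/matrixP => i j; rewrite !mxE; apply: natr_Zp.
have : (map_mx intr A *m map_mx intr B : 'M[F]_r) \in unitmx.
  by rewrite -map_mxM unitmxE det_map_mx unitfE intr_neq0.
move/mulmxV; rewrite -mulmxA => E; apply/row_freeP.
exists (map_mx intr B *m invmx (map_mx intr A *m map_mx intr B)).
by rewrite -[RHS]E; congr (_ *m _); apply/matrixP => i j; rewrite !mxE.
Qed.
End CharacteristicZero.

(** * Independent tangent spaces at explicit points *)

Section TangentSum.
Local Open Scope ring_scope.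
Variables (F : fieldType) (s : nat).

(** The entry at x of the tangent vector in which the coordinate l of the
    factor i of the summand j varies at speed c j i l. Indices are natural
    numbers, so that formats can be compared. *)
Definition tangent_sum (k : nat) (V c : nat -> nat -> nat -> F) (x : nat -> nat) : F :=
  \sum_(j < s) \sum_(i < k) c j i (x i) * \prod_(i' < k | i' != i) V j i' (x i').

(** The sum of the tangent spaces is as large as rescaling permits; setting
    c j i 0 = 0 for i > 0 removes the rescalings of the factors. *)
Definition independent_tangents (k : nat) (n : nat -> nat) (V : nat -> nat -> nat -> F) :=
  forall c : nat -> nat -> nat -> F,
    (forall j i, i != 0 -> c j i 0%N = 0) ->
    (forall x, (forall i, (i < k)%N -> (x i <= n i)%N) -> tangent_sum k V c x = 0) ->
  forall j i l, (j < s)%N -> (i < k)%N -> (l <= n i)%N -> c j i l = 0.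

Fixpoint box (n : seq nat) : seq (seq nat) :=
  if n is n0 :: n' then [seq a :: x | a <- iota 0 n0.+1, x <- box n'] else [:: [::]].

Definition directions (n : seq nat) : seq (nat * (nat * nat)) :=
  [seq q <- [seq (j, q) | j <- iota 0 s,
                          q <- [seq (i, l) | i <- iota 0 (size n), l <- iota 0 (nth 0 n i).+1]]
         | (q.2.1 == 0) || (q.2.2 != 0)].

Definition power (j e : nat) : N.t := iter e (N.mul (N.of_nat j)) N.one.

Definition tangent_entry (n : seq nat) (q : nat * (nat * nat)) (x : seq nat) : N.t :=
  if nth 0 x q.2.1 == q.2.2 then
    foldr (fun i t => if i == q.2.1 then t else N.mul (power q.1 (i.+1 * nth 0 x i)) t) N.one
      (iota 0 (size n))
  else N.zero.

Definition tangent_rows (n : seq nat) : seq (seq N.t) :=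
  [seq [seq tangent_entry n q x | x <- box n] | q <- directions n].

(** The factors lie on rational normal curves (1, t, t^2, ...). The parameter
    t = j^(i+1) of the summand j depends on the factor i in a nonlinear way,
    because affine changes of t are linear automorphisms of the curve: with
    the same parameters up to such changes in all factors, the five points
    would lie on one rational curve of degree n_1 + ... + n_k, which is
    a special position in formats such as (1,1,1,1,1). *)
Definition curve_point (j i l : nat) : F := (j ^ (i.+1 * l))%:R.

Lemma big_iota0 m (f : nat -> F) : \sum_(i <- iota 0 m) f i = \sum_(i < m) f i.
Proof. by rewrite -[m in iota _ m]subn0 -/(index_iota 0 m) big_mkord. Qed.

Lemma mem_box n x : x \in box n -> forall i, (i < size n)%N -> (nth 0%N x i <= nth 0%N n i)%N.
Proof.
elim: n x => [//|n0 n IHn] x.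
move=> /allpairsPdep[a [x' [a_in x'_in ->]]] [_|i lt_i] /=.
  by move: a_in; rewrite mem_iota ltnS.
exact: IHn.
Qed.

Lemma big_directions n (f : nat * (nat * nat) -> F) :
  \sum_(q <- directions n) f q = \sum_(j < s) \sum_(i < size n)
     \sum_(l < (nth 0 n i).+1 | (i == 0 :> nat) || (l != 0 :> nat))
        f (nat_of_ord j, (nat_of_ord i, nat_of_ord l)).
Proof.
rewrite big_filter big_mkcond big_allpairs_dep big_iota0; apply: eq_bigr => j _.
rewrite big_allpairs_dep big_iota0; apply: eq_bigr => i _.
by rewrite big_iota0 [RHS]big_mkcond.
Qed.

Lemma mem_directions n j i l :
    (j < s)%N -> (i < size n)%N -> (l <= nth 0%N n i)%N -> (i == 0)%N || (l != 0)%N ->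
  (j, (i, l)) \in directions n.
Proof.
move=> lt_j lt_i le_l nor; rewrite mem_filter nor andTb.
apply: allpairs_f; first by rewrite mem_iota.
by apply: allpairs_f_dep; rewrite mem_iota.
Qed.

Lemma power_residue j e : residue F (power j e) = (j ^ e)%:R.
Proof.
elim: e => [|e IHe]; first by rewrite expn0.
by rewrite /power iterS residueM -/(power j e) IHe expnS natrM /residue Nnat.Nat2N.id.
Qed.

Lemma tangent_entry_residue n q x : residue F (tangent_entry n q x)
  = (nth 0%N x q.2.1 == q.2.2)%:R
    * \prod_(i' < size n | i' != q.2.1 :> nat) curve_point q.1 i' (nth 0%N x i').
Proof.
rewrite /tangent_entry; case: eqP => _; last by rewrite mul0r.
rewrite mul1r -(big_mkord (fun i' => i' != q.2.1) (fun i' => curve_point q.1 i' (nth 0%N x i'))).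
rewrite /index_iota subn0; elim: (iota _ _) => [|i r IHr]; first by rewrite big_nil.
rewrite big_cons /= -IHr; case: eqP => //= _.
by rewrite residueM power_residue.
Qed.

Lemma rows_tangent_sum n (c : nat -> nat -> nat -> F) x :
    (forall j i, i != 0%N -> c j i 0%N = 0) -> x \in box n ->
  \sum_(q <- directions n) c q.1 q.2.1 q.2.2 * residue F (tangent_entry n q x)
  = tangent_sum (size n) curve_point c (nth 0%N x).
Proof.
move=> c0 x_in; rewrite big_directions; apply: eq_bigr => j _; apply: eq_bigr => i _.
under eq_bigr do rewrite tangent_entry_residue /=.
have lt_x : (nth 0 x i < (nth 0 n i).+1)%N by rewrite ltnS; apply: mem_box.
rewrite big_mkcond (bigD1 (Ordinal lt_x)) //= [X in _ + X]big1 ?addr0 => [|l ne_l].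
  rewrite eqxx mul1r; case: ifP => // /negbT/norP[i_neq0 /negPn/eqP ->].
  by rewrite c0 ?mul0r.
case: ifP => // _; rewrite (_ : nth 0 x i == l = false) ?mul0r ?mulr0 //.
by apply: contraNF ne_l => /eqP eq_l; apply/eqP/val_inj.
Qed.

(** A relation between tangent vectors is a relation between the rows of an
    integral matrix, which are independent modulo p. *)
Lemma curve_points_independent (p : N.t) n : prime (N.to_nat p) ->
    [pchar F] =i pred0 ->
    rows_independent p (size (tangent_rows n)) (tangent_rows n) ->
  independent_tangents (size n) (nth 0%N n) curve_point.
Proof.
move=> pr_p charF0 ind c c0 cT j i l lt_j lt_i le_l.
set rows := tangent_rows n in ind; pose w := size (box n).
pose M (a : 'I_(size rows)) (y : 'I_w) := N.to_nat (nth N.zero (nth [::] rows a) y).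
have nth_rows a y : (a < size rows)%N -> (y < w)%N -> nth N.zero (nth [::] rows a) y
    = tangent_entry n (nth (0, (0, 0)) (directions n) a) (nth [::] (box n) y).
  rewrite size_map => lt_a lt_y; rewrite (nth_map (0, (0, 0))) //.
  by rewrite (nth_map [::]).
have free_p : row_free (\matrix_(a, y) (M a y)%:R : 'M['F_(N.to_nat p)]_(_, _)).
  apply: inj_row_free => u uM; apply/rowP => a; rewrite mxE.
  pose d b := if insub b is Some b' then u 0 b' else 0.
  have dE (b : 'I_(size rows)) : d b = u 0 b by rewrite /d valK.
  rewrite -dE; apply: (rows_independentP (pchar_Fp pr_p) (w := w) _ ind) => //.
    by apply/allP => _ /mapP[q _ ->]; rewrite size_map.
  move=> y lt_y; transitivity ((u *m \matrix_(a, y) (M a y)%:R) 0 (Ordinal lt_y)).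
    by rewrite mxE; apply: eq_bigr => b _; rewrite dE !mxE.
  by rewrite uM mxE.
have := row_free_inj (row_free_mod charF0 pr_p free_p).
have size_rows : size rows = size (directions n) by rewrite size_map.
pose cq q := c q.1 q.2.1 q.2.2.
pose u : 'rV[F]_(size rows) := \row_a cq (nth (0, (0, 0)) (directions n) a).
move=> /(_ _ u 0); rewrite mul0mx => inj; have [|nor] := boolP ((i == 0) || (l != 0)); last first.
  by case/norP: nor => i_neq0 /negPn/eqP->; apply: c0.
move/(mem_directions lt_j lt_i le_l) => q_in.
have lt_q : (index (j, (i, l)) (directions n) < size rows)%N by rewrite size_rows index_mem.
have /rowP/(_ (Ordinal lt_q)) : u = 0.
  apply: inj; apply/rowP => y; rewrite [RHS]mxE mxE.
  have y_in : nth [::] (box n) y \in box n by rewrite mem_nth.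
  transitivity (tangent_sum (size n) curve_point c (nth 0%N (nth [::] (box n) y))).
    2: by apply: cT => i' lt_i'; apply: mem_box.
  rewrite -rows_tangent_sum // (big_nth (0, (0, 0))) -size_rows big_mkord.
  by apply: eq_bigr => a _; rewrite !mxE /M nth_rows.
by rewrite !mxE nth_index.
Qed.
End TangentSum.

(** * Passing to other formats *)

Section Extension.
Local Open Scope ring_scope.
Variables (F : fieldType) (s : nat).

(** Points of the format n0, seen in larger formats. *)
Definition truncate (n0 : seq nat) (V : nat -> nat -> nat -> F) (j i l : nat) : F :=
  if (l <= nth 0%N n0 i)%N then V j i l else 0.

(** Factors beyond the format n0 are the constant vector e_0; at indices that
    are 0 in those factors, they contribute nothing to the tangent vector. *)
Lemma independent_tangents_widen k (n0 : seq nat) V c :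
    (forall j i, V j i 0%N = 1) -> (0 < size n0 <= k)%N ->
    independent_tangents s (size n0) (nth 0%N n0) V ->
    (forall j i, i != 0%N -> c j i 0%N = 0) ->
    (forall x, (forall i, x i <= nth 0 n0 i)%N -> tangent_sum s k (truncate n0 V) c x = 0) ->
  forall j i l, (j < s)%N -> (i < k)%N -> (l <= nth 0 n0 i)%N -> c j i l = 0.
Proof.
move=> V1 /andP[k0_gt0 le_k] ind c0 cT j i l lt_j lt_i le_l.
have [lt_i0|le_i0] := ltnP i (size n0); last first.
  move: le_l; rewrite nth_default // leqn0 => /eqP ->; apply: c0.
  by rewrite -lt0n (leq_trans k0_gt0).
apply: ind => // x le_x; pose x' i := if (i < size n0)%N then x i else 0%N.
rewrite -[RHS](cT x') => [|i']; last first.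
  by rewrite /x'; case: ifP => // /le_x.
apply: eq_bigr => j' _.
rewrite (big_ord_widen_cond k xpredT (fun i => c j' i (x i)
  * \prod_(i' < size n0 | i' != i :> nat) V j' i' (x i'))) //.
rewrite big_mkcond; apply: eq_bigr => i' _; rewrite /x' andTb.
case: ifP => [lt_i'|/negbT ge_i']; last first.
  rewrite c0 ?mul0r // -lt0n; apply: leq_trans k0_gt0 _.
  by rewrite leqNgt.
congr (_ * _).
rewrite (big_ord_widen_cond k (fun i'' => i'' != i' :> nat) (fun i => V j' i (x i))) //.
rewrite big_mkcondr; apply: eq_bigr => i'' _; rewrite /truncate.
by case: ifP => [/le_x ->//|_]; rewrite leq0n V1.
Qed.

(** Going from the box n0 to the box n adds, for each summand and each new
    coordinate l of a factor i, one tangent direction supported on the slice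
    x_i = l. On that slice these are the pure tensors of the remaining
    factors, which are independent because their products with a fixed vector
    are among the old tangent vectors. *)
Lemma independent_tangents_extend k (n0 : seq nat) (n : nat -> nat) V :
    (forall j i, V j i 0%N = 1) -> (0 < size n0 <= k)%N ->
    (forall i, (i < k)%N -> (nth 0 n0 i <= n i)%N) ->
    independent_tangents s (size n0) (nth 0%N n0) V ->
  independent_tangents s k n (truncate n0 V).
Proof.
move=> V1 k0k le_n ind c c0 cT j i l lt_j lt_i le_l.
have k_gt0 : (0 < k)%N by case/andP: k0k => /leq_trans; apply.
have widen := independent_tangents_widen V1 k0k ind.
have [le_l0|gt_l0] := leqP l (nth 0%N n0 i).
  apply: (widen c) le_l0 => // x le_x; apply: cT => i' lt_i'.
  exact: leq_trans (le_x _) (le_n _ lt_i').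
pose oi := Ordinal lt_i.
have slice x : (forall i, x i <= nth 0 n0 i)%N ->
    \sum_(j < s) c j i l * \prod_(i' < k | i' != oi) truncate n0 V j i' (x i') = 0.
  move=> le_x; pose x' i' := if i' == i then l else x i'.
  rewrite -[RHS](cT x') => [|i' lt_i']; last first.
    rewrite /x'; case: eqP => [-> //|_]; exact: leq_trans (le_x _) (le_n _ lt_i').
  apply: eq_bigr => j' _; rewrite [RHS](bigD1 oi) //= [X in _ + X]big1 ?addr0.
    rewrite /x' eqxx; congr (_ * _); apply: eq_bigr => i' ne_i'.
    by rewrite ifN.
  move=> i' ne_i'; rewrite (bigD1 oi) 1?eq_sym //= /x' eqxx.
  by rewrite {1}/truncate leqNgt gt_l0 mul0r mulr0.
(* The fixed vector e_l' must be a normalized direction: e_0 is one if i = 0,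
   and e_1 if the factor i has a coordinate 1. Otherwise the factor i is
   trivial on the box n0, and the products are the summands themselves,
   obtained by varying the factor 0 along itself. *)
have [i_eq0|i_neq0] := eqVneq i 0%N.
  pose c' j' i' (l' : nat) := if i' == 0%N then c j' i l else 0.
  have := widen c' _ _ j 0%N 0%N lt_j k_gt0 (leq0n _).
  rewrite /c' eqxx; apply=> [j' i' /negPf -> //|x le_x].
  rewrite -[RHS](slice x) //; apply: eq_bigr => j' _.
  rewrite [LHS](bigD1 oi) //= [X in _ + X]big1 ?addr0 ?i_eq0 //.
  by move=> i' ne_i'; rewrite ifN ?mul0r //; move: ne_i'; rewrite -val_eqE /= i_eq0.
have [n0i|n0i] := posnP (nth 0%N n0 i); last first.
  pose c' j' i' (l' : nat) := if (i' == i) && (l' == 1%N) then c j' i l else 0.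
  have := widen c' _ _ j i 1%N lt_j lt_i n0i.
  rewrite /c' !eqxx; apply=> [j' i' _|x le_x]; first by rewrite andbF.
  have [xi|xi] := boolP (x i == 1%N); last first.
    rewrite /tangent_sum big1 // => j' _; rewrite big1 // => i' _.
    by case: eqP => [->|_]; rewrite ?(negPf xi) mul0r.
  rewrite -[RHS](slice x) //; apply: eq_bigr => j' _.
  rewrite [LHS](bigD1 oi) //= [X in _ + X]big1 ?addr0 ?eqxx ?xi //.
  by move=> i' ne_i'; rewrite ifN ?mul0r //; rewrite negb_and ne_i'.
pose c' j' i' l' := if i' == 0%N then c j' i l * truncate n0 V j' 0%N l' else 0.
have := widen c' _ _ j 0%N 0%N lt_j k_gt0 (leq0n _).
rewrite /c' eqxx /truncate leq0n V1 mulr1; apply=> [j' i' /negPf -> //|x le_x].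
rewrite -[RHS](slice x) //; apply: eq_bigr => j' _; pose o0 := Ordinal k_gt0.
rewrite [LHS](bigD1 o0) //= [X in _ + X]big1 ?addr0; last first.
  by move=> i' ne_i'; rewrite ifN ?mul0r.
have xi : x i = 0%N by apply/eqP; rewrite -leqn0 -n0i.
rewrite -mulrA; congr (_ * _).
transitivity (\prod_(i' < k) truncate n0 V j' i' (x i')); first by rewrite [RHS](bigD1 o0).
by rewrite [LHS](bigD1 oi) //= {1}/truncate xi leq0n V1 mul1r.
Qed.
End Extension.

Section RankBounds.
Local Open Scope ring_scope.
Variables (F : fieldType) (s k : nat).

Definition nat_point (n : k.-tuple nat) (V : nat -> nat -> nat -> F) (p : 'I_#|param s n|) : F :=
  let q := enum_val p in V q.1 (tag q.2) (tagged q.2).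

Lemma nat_point_par (n : k.-tuple nat) V j i l :
  nat_point V (@par s k n j i l) = V j i l.
Proof. by rewrite /nat_point enum_rankK. Qed.

Lemma rank_ge_independent (n : k.-tuple nat) V : (0 < k)%N ->
    independent_tangents s k (nth 0%N n) V ->
  (s * (\sum_(i < k) tnth n i).+1
     <= \rank (jacobian (secant_map F s n) (nat_point V)))%N.
Proof.
move=> k_gt0 ind; rewrite -card_normalized //; apply: rank_ge_normalized => c c0 cJ.
pose C j i l := if insub j is Some j' then if insub i is Some i' then
  c 0 (@par s k n j' i' (inord l)) else 0 else 0.
have CE (j : 'I_s) (i : 'I_k) l : C j i l = c 0 (@par s k n j i (inord l)).
  by rewrite /C !valK.
apply/rowP => p; rewrite mxE -(enum_valK p); case: (enum_val p) => j [i l].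
have := CE j i l; rewrite inord_val => <-; apply: (ind C) => //.
- move=> j' i' i'_neq0; rewrite /C; case: insubP => // j1 _ _.
  case: insubP => // i1 _ i1E; apply: c0.
  by rewrite /normalized /= i1E (negPf i'_neq0) inordK.
- move=> x le_x; pose X := enum_rank ([ffun i : 'I_k => inord (x i)] : tensor_index n).
  have /rowP/(_ X) := cJ; rewrite mul_jacobian_secant_map mxE => <-.
  apply: eq_bigr => j' _; apply: eq_bigr => i' _.
  rewrite CE /multi_index enum_rankK ffunE; congr (_ * _); apply: eq_bigr => i'' _.
  by rewrite ffunE nat_point_par inordK // ltnS (tnth_nth 0%N) le_x.
- by rewrite -(tnth_nth 0%N) -ltnS.
Qed.

Lemma row_free_rowsub r w r' (A : 'M[F]_(r, w)) (e : 'I_r' -> 'I_r) :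
  injective e -> row_free A -> row_free (rowsub e A).
Proof.
move=> inj_e free_A; apply: inj_row_free => u; rewrite rowsubE mulmxA => uA.
have /rowP u0 : u *m rowsub e 1%:M = 0.
  by apply: (row_free_inj free_A); rewrite uA mul0mx.
apply/rowP => a; have := u0 (e a); rewrite mxE [RHS]mxE (bigD1 a) //= !mxE eqxx mulr1.
rewrite big1 ?addr0 // => b ne_ba.
by rewrite !mxE (inj_eq inj_e) (negPf ne_ba) mulr0.
Qed.

(** Projecting away coordinates maps tangent spaces onto tangent spaces, so
    tangent spaces that fill the big space still fill the small one. *)
Lemma rank_full_truncate (n n0 : k.-tuple nat) V :
    (forall i, tnth n i <= tnth n0 i)%N ->
    row_free (jacobian (secant_map F s n0) (nat_point V)) ->
  row_free (jacobian (secant_map F s n) (nat_point V)).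
Proof.
move=> le_n; set J0 := jacobian _ _; set J := jacobian _ _ => free_J0.
pose e (x : 'I_#|tensor_index n|) :=
  enum_rank ([ffun i => inord (multi_index x i)] : tensor_index n0).
have le_x (x : 'I_#|tensor_index n|) i : (multi_index x i < (tnth n0 i).+1)%N.
  by apply: leq_trans (ltn_ord (multi_index x i : 'I_(tnth n i).+1)) _; rewrite ltnS le_n.
have e_idx x i : multi_index (e x) i = multi_index x i :> nat.
  by rewrite /multi_index enum_rankK ffunE inordK // le_x.
have inj_e : injective e.
  move=> x y eq_e; apply: enum_val_inj; apply/ffunP => i; apply: val_inj => /=.
  by rewrite -[LHS]e_idx eq_e e_idx.
have /eqP rk := row_free_rowsub inj_e free_J0.
rewrite /row_free eqn_leq rank_leq_row -[leqLHS]rk -mxrank_tr -[leqRHS]mxrank_tr.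
apply/mxrankS/row_subP => p; rewrite -(enum_valK p); case: (enum_val p) => j [i l].
have JE x i' l' : J x (@par s k n j i' l') = _ := jacobian_secant_map _ x j l'.
have J0E x l' : J0 x (@par s k n0 j i l') = _ := jacobian_secant_map _ x j l'.
rewrite -[enum_rank _]/(@par s k n0 j i l); clearbody J J0.
have [le_l|gt_l] := leqP l (tnth n i); last first.
  rewrite (_ : row _ _ = 0) ?sub0mx //; apply/rowP => x; rewrite !mxE J0E -val_eqE /= e_idx.
  by rewrite ltn_eqF ?mul0r // (leq_ltn_trans _ gt_l) // -ltnS.
apply: (eq_row_sub (@par s k n j i (inord l))); apply/rowP => x; rewrite !mxE.
rewrite JE J0E -!val_eqE /= e_idx inordK //; congr (_ * _).
by apply: eq_bigr => i' _; rewrite !nat_point_par e_idx.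
Qed.
End RankBounds.

(** * Hyperplanes that contain all tangent spaces *)

Section UpperBounds.
Local Open Scope ring_scope.
Variables (F : fieldType) (s k : nat) (n : k.-tuple nat).
Local Notation N := #|tensor_index n|.
Local Notation m := #|param s n|.

Definition initial_coordinates : {mpoly F[m]} :=
  \prod_(j < s) \prod_(i < k) 'X_(@par s k n j i ord0).

Lemma initial_coordinates_neq0 : initial_coordinates != 0.
Proof.
apply/prodf_neq0 => j _; apply/prodf_neq0 => i _.
by apply/eqP => /(congr1 (meval (fun _ => 1)))/eqP; rewrite mevalXU meval0 oner_eq0.
Qed.

Lemma euler_tangent v (j : 'I_s) (i : 'I_k) (x : 'I_N) :
  \sum_l v (@par s k n j i l) * (jacobian (secant_map F s n) v) x (@par s k n j i l)
  = \prod_(i' < k) v (@par s k n j i' (multi_index x i')).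
Proof.
rewrite (bigD1 (multi_index x i)) //= [X in _ + X]big1 ?addr0 => [|l ne_l].
  by rewrite jacobian_secant_map eqxx mul1r [RHS](bigD1 i).
by rewrite jacobian_secant_map eq_sym (negPf ne_l) mul0r mulr0.
Qed.

(** Varying a factor along itself gives the summand, whichever factor it is.
    This expresses the directions left out of [normalized] by the others. *)
Lemma rank_le_normalized v : (0 < k)%N -> initial_coordinates.@[v] != 0 ->
  (\rank (jacobian (secant_map F s n) v) <= s * (\sum_(i < k) tnth n i).+1)%N.
Proof.
move=> k_gt0; rewrite -card_normalized // rmorph_prod => /prodf_neq0 nz_v.
have {}nz_v j i : v (@par s k n j i ord0) != 0.
  have := nz_v j isT; rewrite rmorph_prod => /prodf_neq0/(_ i isT).
  by rewrite /= mevalXU.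
have euler := euler_tangent v; set J := jacobian _ v in euler *; clearbody J.
pose f (a : 'I_#|normalized (s := s) (n := n)|) := enum_rank (enum_val a : param s n).
suff: (J^T <= rowsub f J^T)%MS.
  by move/mxrankS; rewrite mxrank_tr => /leq_trans; apply; apply: rank_leq_row.
have norm_in (q : param s n) : normalized q -> (row (enum_rank q) J^T <= rowsub f J^T)%MS.
  move=> nq; apply: (eq_row_sub (enum_rank_in nq q)); apply/rowP => x.
  by rewrite !mxE /f enum_rankK_in.
apply/row_subP => p; rewrite -(enum_valK p); case: (enum_val p) => j [i l].
have [|nor] := boolP (normalized ((j, Tagged (fun i => 'I_(tnth n i).+1) l) : param s n)).
  exact: norm_in.
have [i_neq0 /negPn/eqP l0] := norP nor.
rewrite -[enum_rank _]/(@par s k n j i l) (_ : l = ord0); last exact: val_inj.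
pose i0 := Ordinal k_gt0.
have -> : row (@par s k n j i ord0) J^T
    = (v (@par s k n j i ord0))^-1 *:
      (\sum_l' v (@par s k n j i0 l') *: row (@par s k n j i0 l') J^T
       - \sum_(l' | l' != ord0) v (@par s k n j i l') *: row (@par s k n j i l') J^T).
  apply/rowP => x; rewrite !mxE !summxE.
  under eq_bigr do rewrite !mxE.
  under [X in _ - X]eq_bigr do rewrite !mxE.
  rewrite euler -(euler j i x) (bigD1 ord0) //= addrK.
  by rewrite mulKf.
apply: scalemx_sub; apply: addmx_sub; last rewrite eqmx_opp.
  by apply: summx_sub => l' _; apply: scalemx_sub; apply: norm_in.
apply: summx_sub => l' l'_neq0; apply: scalemx_sub; apply: norm_in.
by rewrite /normalized /= l'_neq0 orbT.
Qed.

(** The forms beta are equations of independent hyperplanes that contain all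
    the tangent spaces. *)
Lemma rank_conormal v (I : finType) (beta : I -> tensor_index n -> F) :
    (forall b (j : 'I_s) (i : 'I_k) (l : 'I_(tnth n i).+1), \sum_(x : tensor_index n)
       (x i == l)%:R * (\prod_(i' < k | i' != i) v (@par s k n j i' (x i'))) * beta b x = 0) ->
    (forall c : I -> F, (forall x, \sum_b c b * beta b x = 0) -> forall b, c b = 0) ->
  (\rank (jacobian (secant_map F s n) v) + #|I| <= N)%N.
Proof.
move=> tan0 ind; set J := jacobian _ v.
pose B : 'M[F]_(N, #|I|) := \matrix_(x, b) beta (enum_val b) (enum_val x).
have JB : J^T *m B = 0.
  apply/matrixP => p b; rewrite -(enum_valK p); case: (enum_val p) => j [i l].
  rewrite !mxE -[RHS](tan0 (enum_val b) j i l).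
  rewrite [RHS](reindex (fun x : 'I_N => enum_val x : tensor_index n)) /=; last first.
    exact/onW_bij/(Bijective enum_valK enum_rankK).
  apply: eq_bigr => x _; rewrite mxE.
  by rewrite -[enum_rank _]/(@par s k n j i l) jacobian_secant_map mxE.
have rkB : \rank B = #|I|.
  apply/eqP; rewrite -mxrank_tr -/(row_free _); apply: inj_row_free => c cB.
  apply/rowP => b; rewrite mxE -(enum_valK b).
  apply: (ind (fun b => c 0 (enum_rank b))) => x.
  have /rowP/(_ (enum_rank x)) := cB; rewrite !mxE => E; rewrite -[RHS]E.
  rewrite (reindex (fun b' : 'I_#|I| => enum_val b' : I)) /=; last first.
    exact/onW_bij/(Bijective enum_valK enum_rankK).
  by apply: eq_bigr => b' _; rewrite !mxE enum_valK enum_rankK.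
by rewrite -(mxrank_tr J) -rkB; apply: mulmx0_rank_max.
Qed.
End UpperBounds.

Section ThreeFactors.
Local Open Scope ring_scope.
Variables (F : fieldType) (s : nat) (n : 3.-tuple nat).
Definition t0 : 'I_3 := ord0.
Definition t1 : 'I_3 := lift ord0 ord0.
Definition t2 : 'I_3 := lift ord0 (lift ord0 ord0).

Lemma ord3_ind (P : forall i : 'I_3, 'I_(tnth n i).+1 -> Prop) :
  (forall l, P t0 l) -> (forall l, P t1 l) -> (forall l, P t2 l) -> forall i l, P i l.
Proof.
move=> P0 P1 P2 i.
case: (unliftP ord0 i) => [i1|] -> //.
case: (unliftP ord0 i1) => [i2|] -> //.
by rewrite (ord1 i2).
Qed.

Lemma big_tensor3 (G : 'I_(tnth n t0).+1 -> 'I_(tnth n t1).+1 -> 'I_(tnth n t2).+1 -> F) :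
  \sum_(x : tensor_index n) G (x t0) (x t1) (x t2) = \sum_a \sum_b \sum_c G a b c.
Proof.
pose h (x : tensor_index n) := (x t0, (x t1, x t2)).
pose h' (t : 'I_(tnth n t0).+1 * ('I_(tnth n t1).+1 * 'I_(tnth n t2).+1)) : tensor_index n :=
  [ffun i : 'I_3 => inord (nth 0%N [:: nat_of_ord t.1; nat_of_ord t.2.1; nat_of_ord t.2.2] i)].
under [RHS]eq_bigr do rewrite pair_bigA.
rewrite pair_bigA [RHS](reindex h) //.
exists h' => [x _|[a [b c]] _]; last by rewrite /h !ffunE !inord_val.
apply/ffunP => i; rewrite ffunE; case: (unliftP ord0 i) => [i1|] -> /=.
  case: (unliftP ord0 i1) => [i2|] -> /=; last by rewrite inord_val.
  by rewrite (ord1 i2) inord_val.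
by rewrite inord_val.
Qed.

Lemma prod3_but (f : 'I_3 -> F) :
  (\prod_(i | i != t0) f i = f t1 * f t2) * (\prod_(i | i != t1) f i = f t0 * f t2)
  * (\prod_(i | i != t2) f i = f t0 * f t1).
Proof.
by split; first split; rewrite big_mkcond !big_ord_recl big_ord0 /= ?mul1r ?mulr1.
Qed.

Lemma rank_conormal3 v (I : finType)
    (beta : I -> 'I_(tnth n t0).+1 -> 'I_(tnth n t1).+1 -> 'I_(tnth n t2).+1 -> F) :
    (forall b (j : 'I_s) x, \sum_y \sum_z
       v (@par s 3 n j t1 y) * v (@par s 3 n j t2 z) * beta b x y z = 0) ->
    (forall b (j : 'I_s) y, \sum_x \sum_z
       v (@par s 3 n j t0 x) * v (@par s 3 n j t2 z) * beta b x y z = 0) ->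
    (forall b (j : 'I_s) z, \sum_x \sum_y
       v (@par s 3 n j t0 x) * v (@par s 3 n j t1 y) * beta b x y z = 0) ->
    (forall c : I -> F, (forall x y z, \sum_b c b * beta b x y z = 0) -> forall b, c b = 0) ->
  (\rank (jacobian (secant_map F s n) v) + #|I| <= #|tensor_index n|)%N.
Proof.
move=> tan0 tan1 tan2 ind.
apply: (@rank_conormal _ _ _ _ _ _ (fun b x => beta b (x t0) (x t1) (x t2))); last first.
  move=> c c0; apply: ind => x y z.
  pose X : tensor_index n := [ffun i : 'I_3 => inord (nth 0%N [:: x : nat; y : nat; z : nat] i)].
  by have := c0 X; rewrite !ffunE !inord_val.
move=> b j; apply: ord3_ind => l.
- rewrite -[RHS](tan0 b j l); under eq_bigr do rewrite prod3_but.
  rewrite (big_tensor3 (fun x y z => (x == l)%:R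
    * (v (@par s 3 n j t1 y) * v (@par s 3 n j t2 z)) * beta b x y z)).
  rewrite (bigD1 l) //= [X in _ + X]big1 ?addr0 => [|x /negPf ->].
    by apply: eq_bigr => y _; apply: eq_bigr => z _; rewrite eqxx mul1r.
  by rewrite big1 // => y _; rewrite big1 // => z _; rewrite !mul0r.
- rewrite -[RHS](tan1 b j l); under eq_bigr do rewrite prod3_but.
  rewrite (big_tensor3 (fun x y z => (y == l)%:R
    * (v (@par s 3 n j t0 x) * v (@par s 3 n j t2 z)) * beta b x y z)).
  apply: eq_bigr => x _; rewrite (bigD1 l) //= [X in _ + X]big1 ?addr0 => [|y /negPf ->].
    by apply: eq_bigr => z _; rewrite eqxx mul1r.
  by rewrite big1 // => z _; rewrite !mul0r.
- rewrite -[RHS](tan2 b j l); under eq_bigr do rewrite prod3_but.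
  rewrite (big_tensor3 (fun x y z => (z == l)%:R
    * (v (@par s 3 n j t0 x) * v (@par s 3 n j t1 y)) * beta b x y z)).
  apply: eq_bigr => x _; apply: eq_bigr => y _.
  rewrite (bigD1 l) //= [X in _ + X]big1 ?addr0 => [|z /negPf ->].
    by rewrite eqxx mul1r.
  by rewrite !mul0r.
Qed.

(** Let the pairs of the first two factors span W and the third factors span
    U. A product of a linear form vanishing on W with a linear form vanishing
    on U vanishes to first order at every summand. *)
Lemma rank_unbalanced v :
  (\rank (jacobian (secant_map F s n) v)
     + ((tnth n t0).+1 * (tnth n t1).+1 - s) * ((tnth n t2).+1 - s) <= #|tensor_index n|)%N.
Proof.
set d0 := (tnth n t0).+1; set d1 := (tnth n t1).+1; set d2 := (tnth n t2).+1.
pose W : 'M[F]_(s, d0 * d1) := \matrix_j mxvec (\matrix_(x, y)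
  (v (@par s 3 n j t0 x) * v (@par s 3 n j t1 y))).
pose U : 'M[F]_(s, d2) := \matrix_(j, z) v (@par s 3 n j t2 z).
pose X := row_base (kermx W^T); pose Y := row_base (kermx U^T).
have XW : X *m W^T = 0 by apply/sub_kermxP; rewrite eq_row_base.
have YU : Y *m U^T = 0 by apply/sub_kermxP; rewrite eq_row_base.
have kerX : (d0 * d1 - s <= \rank (kermx W^T))%N.
  by rewrite mxrank_ker leq_sub2l // rank_leq_col.
have kerY : (d2 - s <= \rank (kermx U^T))%N.
  by rewrite mxrank_ker leq_sub2l // rank_leq_col.
have X0 p j : \sum_x \sum_y v (@par s 3 n j t0 x) * v (@par s 3 n j t1 y)
    * X p (mxvec_index x y) = 0.
  have /matrixP/(_ p j) := XW; rewrite !mxE => E; rewrite -[RHS]E.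
  rewrite pair_bigA [RHS](reindex _ (curry_mxvec_bij _ _)).
  by apply: eq_bigr => -[x y] _; rewrite !mxE mxvecE mxE mulrC.
have Y0 q j : \sum_z v (@par s 3 n j t2 z) * Y q z = 0.
  have /matrixP/(_ q j) := YU; rewrite !mxE => E; rewrite -[RHS]E.
  by apply: eq_bigr => z _; rewrite !mxE mulrC.
pose I : finType := ('I_(\rank (kermx W^T)) * 'I_(\rank (kermx U^T)))%type.
apply: (@leq_trans (\rank (jacobian (secant_map F s n) v) + #|I|)).
  by rewrite leq_add2l card_prod !card_ord leq_mul.
apply: (@rank_conormal3 v _ (fun b x y z => X b.1 (mxvec_index x y) * Y b.2 z)).
- move=> b j x; rewrite big1 // => y _.
  by under eq_bigr do rewrite mulrACA; rewrite -mulr_sumr Y0 mulr0.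
- move=> b j y; rewrite big1 // => x _.
  by under eq_bigr do rewrite mulrACA; rewrite -mulr_sumr Y0 mulr0.
- move=> b j z; rewrite -[RHS](mul0r (Y b.2 z)) -[in RHS](X0 b.1 j) mulr_suml.
  by apply: eq_bigr => x _; rewrite mulr_suml; apply: eq_bigr => y _; rewrite mulrA.
move=> c c0 [p q].
pose C : 'M[F]_(_, _) := \matrix_(p, q) c (p, q).
have XCY : X^T *m C *m Y = 0.
  apply/matrixP => e z; rewrite mxE.
  case/mxvec_indexP: e => x y; rewrite [RHS]mxE -[RHS](c0 x y z).
  under eq_bigr do rewrite mxE mulr_suml.
  rewrite exchange_big pair_bigA; apply: eq_bigr => -[p' q'] _.
  by rewrite [X^T _ _]mxE [C _ _]mxE mulrA [c _ * _]mulrC.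
have XC : X^T *m C = 0.
  by apply: (row_free_inj (row_base_free (kermx U^T))); rewrite -/Y XCY mul0mx.
have C0 : C^T = 0.
  apply: (row_free_inj (row_base_free (kermx W^T))); rewrite mul0mx -/X.
  by rewrite -[X]trmxK -trmx_mul XC trmx0.
by have /matrixP/(_ q p) := C0; rewrite !mxE.
Qed.
End ThreeFactors.

(** * The format (2,3,3) *)

Section ConormalVectors.
Local Open Scope ring_scope.
Variable F : fieldType.

(** The cross product: sum_x f x * cross g h x is the determinant of f, g, h. *)
Definition cross (f g : 'I_3 -> F) (x : 'I_3) : F :=
  if x == t0 then f t1 * g t2 - f t2 * g t1
  else if x == t1 then f t2 * g t0 - f t0 * g t2
  else f t0 * g t1 - f t1 * g t0.

Lemma cross_sumr (J : finType) (f : 'I_3 -> F) (c : J -> F) (u : J -> 'I_3 -> F) x :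
  \sum_z c z * cross f (u z) x = cross f (fun x => \sum_z c z * u z x) x.
Proof.
have dist e1 e2 e3 e4 : \sum_z c z * (f e1 * u z e2 - f e3 * u z e4)
    = f e1 * (\sum_z c z * u z e2) - f e3 * (\sum_z c z * u z e4).
  by rewrite !mulr_sumr -sumrB; apply: eq_bigr => z _ /=; ring.
by rewrite /cross; case: ifP => _; last case: ifP => _.
Qed.

Lemma cross_suml (I : finType) (b : I -> F) (w : I -> 'I_3 -> F) (g : 'I_3 -> F) x :
  \sum_y b y * cross (w y) g x = cross (fun x => \sum_y b y * w y x) g x.
Proof.
have dist e1 e2 e3 e4 : \sum_y b y * (w y e1 * g e2 - w y e3 * g e4)
    = (\sum_y b y * w y e1) * g e2 - (\sum_y b y * w y e3) * g e4.
  by rewrite !mulr_suml -sumrB; apply: eq_bigr => y _ /=; ring.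
by rewrite /cross; case: ifP => _; last case: ifP => _.
Qed.

Lemma cross_sum (I J : finType) (b : I -> F) (c : J -> F) (w : I -> 'I_3 -> F)
    (u : J -> 'I_3 -> F) x :
  \sum_y \sum_z b y * c z * cross (w y) (u z) x
  = cross (fun x => \sum_y b y * w y x) (fun x => \sum_z c z * u z x) x.
Proof.
rewrite -cross_suml; apply: eq_bigr => y _; rewrite -cross_sumr mulr_sumr.
by apply: eq_bigr => z _; rewrite mulrA.
Qed.

Lemma crossZl t f g x : cross (fun x => t * f x) g x = t * cross f g x.
Proof. by rewrite /cross; case: ifP => _; last case: ifP => _; ring. Qed.

Lemma cross_anti f g x : cross g f x = - cross f g x.
Proof. by rewrite /cross; case: ifP => _; last case: ifP => _; ring. Qed.

Lemma eq_cross f f' g g' x : f =1 f' -> g =1 g' -> cross f g x = cross f' g' x.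
Proof. by move=> ef eg; rewrite /cross !ef !eg. Qed.

Lemma cross_dot f t g : \sum_x f x * cross (fun x => t * f x) g x = 0.
Proof. by rewrite !big_ord_recl big_ord0 /cross /=; rewrite -/t1 -/t2 -/t0; ring. Qed.

Lemma cross_parallel f t t' x : cross (fun x => t * f x) (fun x => t' * f x) x = 0.
Proof. by rewrite /cross; case: ifP => _; last case: ifP => _; ring. Qed.

Lemma nonsingular_system_eq0 d (g : 'I_d -> 'I_d -> F) (h : 'I_d -> F) :
    \det (\matrix_(i, l) g i l) != 0 -> (forall i, \sum_l g i l * h l = 0) ->
  forall l, h l = 0.
Proof.
rewrite -unitfE -unitmxE; set G := matrix_of_fun _ _ => unit_g gh0 l.
have Gh : G *m \col_l h l = 0.
  apply/colP => i; rewrite !mxE -[RHS](gh0 i).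
  by apply: eq_bigr => l' _; rewrite !mxE.
have /colP/(_ l) : \col_l h l = 0 by rewrite -(mulKmx unit_g (\col_l h l)) Gh mulmx0.
by rewrite !mxE.
Qed.

Section TwoThreeThree.
Variables (a : 'I_5 -> 'I_3 -> F) (b c : 'I_5 -> 'I_4 -> F).
Hypothesis a_neq0 : forall j, a j t0 != 0.
Hypothesis a_indep : forall i j, i != j -> a i t0 * a j t1 - a i t1 * a j t0 != 0.
Hypothesis b_indep : forall j : 'I_5, \det (\matrix_(i < 4, l < 4) b (lift j i) l) != 0.
Hypothesis c_indep : forall j : 'I_5, \det (\matrix_(i < 4, l < 4) c (lift j i) l) != 0.

(** The linear maps from F^4 to F^3 that send each of five given vectors into
    the line of the corresponding a_j: twelve unknowns, ten equations. *)
Lemma incidence_maps (g : 'I_5 -> 'I_4 -> F) :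
  exists r (w : 'I_r -> 'I_4 -> 'I_3 -> F) (mu : 'I_r -> 'I_5 -> F),
  [/\ (2 <= r)%N,
      forall p j x, \sum_y g j y * w p y x = mu p j * a j x &
      forall d : 'I_r -> F, (forall y x, \sum_p d p * w p y x = 0) -> forall p, d p = 0].
Proof.
pose eqn (j : 'I_5) (e : 'I_2) (y : 'I_4) (x : 'I_3) : F :=
  g j y * ((x == lift t0 e)%:R * a j t0 - (x == t0)%:R * a j (lift t0 e)).
pose M : 'M[F]_(4 * 3, 5 * 2) := \matrix_(i, l)
  mxvec (\matrix_(y, x) mxvec (\matrix_(j, e) eqn j e y x) 0 l) 0 i.
pose S := row_base (kermx M).
have SM : S *m M = 0 by apply/sub_kermxP; rewrite eq_row_base.
pose w (p : 'I_(\rank (kermx M))) y x := S p (mxvec_index y x).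
have w_line p j x : (\sum_y g j y * w p y x) * a j t0 = (\sum_y g j y * w p y t0) * a j x.
  case: (unliftP t0 x) => [e ->|-> //].
  have /matrixP/(_ p (mxvec_index j e)) := SM; rewrite [RHS]mxE mxE.
  rewrite (reindex _ (curry_mxvec_bij _ _)) /= => Eje.
  apply/eqP; rewrite -subr_eq0 -[X in _ == X]Eje; apply/eqP.
  have delta (f : 'I_3 -> F) e' : \sum_x f x * (x == e')%:R = f e'.
    rewrite (bigD1 e') //= eqxx mulr1 big1 ?addr0 // => x' /negPf ->.
    by rewrite mulr0.
  transitivity (\sum_y \sum_x w p y x * eqn j e y x).
    rewrite !mulr_suml -sumrB; apply: eq_bigr => y _.
    rewrite -[w p y (lift t0 e)](delta (w p y)) -[w p y t0](delta (w p y)).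
    rewrite !mulr_sumr !mulr_suml -sumrB; apply: eq_bigr => x' _.
    by rewrite /eqn; ring.
  rewrite pair_bigA; apply: eq_bigr => -[y x'] _; congr (_ * _).
  by rewrite !mxE mxvecE mxE mxvecE mxE.
exists (\rank (kermx M)), w, (fun p j => (\sum_y g j y * w p y t0) / a j t0); split.
- by rewrite mxrank_ker; apply: leq_trans (leq_sub2l _ (rank_leq_col M)).
- by move=> p j x; rewrite mulrAC -w_line mulfK.
move=> d dw0 p; have: \row_p d p *m S = 0.
  apply/rowP => i; case/mxvec_indexP: i => y x.
  by rewrite mxE [RHS]mxE -[RHS](dw0 y x); apply: eq_bigr => q _; rewrite mxE.
rewrite -[RHS](mul0mx _ S) => /(row_free_inj (row_base_free _))/rowP/(_ p).
by rewrite !mxE.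
Qed.

(** With w b_j and u c_j both on the line of a_j, the trilinear form
    det(x, w y, u z) vanishes on each of the three tangent directions at
    a_j, b_j, c_j, since two of its arguments stay parallel. Each of w and u
    varies in a space of dimension at least two, hence four such forms. *)
Lemma conormals_233 :
  exists (I : finType) (beta : I -> 'I_3 -> 'I_4 -> 'I_4 -> F),
  [/\ (4 <= #|I|)%N,
      forall i j x, \sum_y \sum_z b j y * c j z * beta i x y z = 0,
      forall i j y, \sum_x \sum_z a j x * c j z * beta i x y z = 0,
      forall i j z, \sum_x \sum_y a j x * b j y * beta i x y z = 0 &
      forall d : I -> F, (forall x y z, \sum_i d i * beta i x y z = 0) -> forall i, d i = 0].
Proof.
have [r [w [mu [r_ge2 wE w_free]]]] := incidence_maps b.
have [r' [u [la [r'_ge2 uE u_free]]]] := incidence_maps c.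
pose I : finType := ('I_r * 'I_r')%type.
exists I, (fun i x y z => cross (w i.1 y) (u i.2 z) x); split.
- by rewrite card_prod !card_ord (@leq_mul 2 2).
- move=> i j x; rewrite cross_sum (eq_cross _ (wE _ _) (uE _ _)).
  exact: cross_parallel.
- move=> i j y; under eq_bigr => x _ do under eq_bigr do rewrite -mulrA.
  under eq_bigr => x _ do rewrite -mulr_sumr cross_sumr
    (eq_cross _ (frefl _) (uE _ _)) cross_anti mulrN.
  by rewrite sumrN cross_dot oppr0.
- move=> i j z; under eq_bigr => x _ do under eq_bigr do rewrite -mulrA.
  under eq_bigr => x _ do rewrite -mulr_sumr cross_suml (eq_cross _ (wE _ _) (frefl _)).
  exact: cross_dot.
rewrite /I => d d0.
(* At y = b_j the relation says that a combination u' of the u_q takes all its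
   values on the line of a_j. For i != j it also maps c_i into the line of a_i,
   so it kills four of the c_i, and u' = 0. *)
have d_mu j q : \sum_p d (p, q) * mu p j = 0.
  apply: (u_free (fun q => \sum_p d (p, q) * mu p j)) => z x.
  move: z; apply: (nonsingular_system_eq0 (c_indep j)) => i'.
  set i := lift j i'; have ne_ij : i != j by rewrite eq_sym neq_lift.
  set l := \sum_q (\sum_p d (p, q) * mu p j) * la q i.
  have lE x' : \sum_z c i z * (\sum_q (\sum_p d (p, q) * mu p j) * u q z x') = l * a i x'.
    under eq_bigr do rewrite mulr_sumr; rewrite exchange_big mulr_suml.
    apply: eq_bigr => q' _; rewrite -mulrA -uE mulr_sumr.
    by apply: eq_bigr => z _; rewrite mulrCA.
  suff l0 : l = 0 by rewrite lE l0 mul0r.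
  have: cross (a j) (fun x => l * a i x) t2 = 0.
    rewrite -(eq_cross _ (frefl _) lE) -cross_sumr big1 // => z _.
    rewrite -cross_sumr; apply/eqP; rewrite mulf_eq0; apply/orP; right; apply/eqP.
    transitivity (\sum_y b j y * \sum_i d i * cross (w i.1 y) (u i.2 z) t2); last first.
      by rewrite big1 // => y _; rewrite d0 mulr0.
    under [RHS]eq_bigr do rewrite mulr_sumr.
    under [LHS]eq_bigr do rewrite mulr_suml.
    rewrite [RHS]exchange_big [LHS]exchange_big pair_bigA; apply: eq_bigr => -[p' q'] _ /=.
    under eq_bigr do rewrite mulrCA; rewrite -mulr_sumr cross_suml.
    by rewrite (eq_cross _ (wE _ _) (frefl _)) crossZl mulrA.
  rewrite /cross /= => /eqP; rewrite -/t0 -/t1.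
  rewrite (_ : _ - _ = l * (a j t0 * a i t1 - a j t1 * a i t0)); last by ring.
  by rewrite mulf_eq0 (negPf (a_indep _)) 1?eq_sym // orbF => /eqP.
case=> p q; move: p; apply: w_free => y x; move: y.
apply: (nonsingular_system_eq0 (b_indep ord0)) => j.
under eq_bigr do rewrite mulr_sumr; rewrite exchange_big /=.
under eq_bigr => p _ do (under eq_bigr do rewrite mulrCA; rewrite -mulr_sumr wE mulrA).
by rewrite -mulr_suml d_mu mul0r.
Qed.
End TwoThreeThree.
End ConormalVectors.

(** * The format (1,1,2,2) *)

Section FourFactors.
Local Open Scope ring_scope.
Variables (F : fieldType) (s : nat) (n : 4.-tuple nat).
Definition q0 : 'I_4 := ord0.
Definition q1 : 'I_4 := lift ord0 ord0.
Definition q2 : 'I_4 := lift ord0 (lift ord0 ord0).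
Definition q3 : 'I_4 := lift ord0 (lift ord0 (lift ord0 ord0)).

Lemma ord4_ind (P : forall i : 'I_4, 'I_(tnth n i).+1 -> Prop) :
    (forall l, P q0 l) -> (forall l, P q1 l) -> (forall l, P q2 l) -> (forall l, P q3 l) ->
  forall i l, P i l.
Proof.
move=> P0 P1 P2 P3 i.
case: (unliftP ord0 i) => [i1|] -> //.
case: (unliftP ord0 i1) => [i2|] -> //.
case: (unliftP ord0 i2) => [i3|] -> //.
by rewrite (ord1 i3).
Qed.

Lemma big_tensor4 (G : 'I_(tnth n q0).+1 -> 'I_(tnth n q1).+1 -> 'I_(tnth n q2).+1 ->
    'I_(tnth n q3).+1 -> F) :
  \sum_(x : tensor_index n) G (x q0) (x q1) (x q2) (x q3)
  = \sum_a \sum_b \sum_c \sum_d G a b c d.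
Proof.
pose h (x : tensor_index n) := (x q0, (x q1, (x q2, x q3))).
pose h' (t : 'I_(tnth n q0).+1 * ('I_(tnth n q1).+1 * ('I_(tnth n q2).+1 * 'I_(tnth n q3).+1)))
    : tensor_index n :=
  [ffun i : 'I_4 => inord (nth 0%N [:: nat_of_ord t.1; nat_of_ord t.2.1;
                                       nat_of_ord t.2.2.1; nat_of_ord t.2.2.2] i)].
under [RHS]eq_bigr do (under eq_bigr do rewrite pair_bigA; rewrite pair_bigA).
rewrite pair_bigA [RHS](reindex h) //.
exists h' => [x _|[a [b [c d]]] _]; last by rewrite /h !ffunE !inord_val.
apply/ffunP => i; rewrite ffunE; case: (unliftP ord0 i) => [i1|] -> /=.
  case: (unliftP ord0 i1) => [i2|] -> /=; last by rewrite inord_val.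
  case: (unliftP ord0 i2) => [i3|] -> /=; last by rewrite inord_val.
  by rewrite (ord1 i3) inord_val.
by rewrite inord_val.
Qed.

Lemma prod4_but (f : 'I_4 -> F) :
  (\prod_(i | i != q0) f i = f q1 * f q2 * f q3) * (\prod_(i | i != q1) f i = f q0 * f q2 * f q3)
  * (\prod_(i | i != q2) f i = f q0 * f q1 * f q3) * (\prod_(i | i != q3) f i = f q0 * f q1 * f q2).
Proof.
by do ![split]; rewrite big_mkcond !big_ord_recl big_ord0 /= ?mul1r ?mulr1 ?mulrA.
Qed.

Lemma rank_conormal4 v (I : finType)
    (beta : I -> 'I_(tnth n q0).+1 -> 'I_(tnth n q1).+1 -> 'I_(tnth n q2).+1 ->
      'I_(tnth n q3).+1 -> F) :
    let V j i l := v (@par s 4 n j i l) in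
    (forall b (j : 'I_s) x, \sum_y \sum_z \sum_t
       V j q1 y * V j q2 z * V j q3 t * beta b x y z t = 0) ->
    (forall b (j : 'I_s) y, \sum_x \sum_z \sum_t
       V j q0 x * V j q2 z * V j q3 t * beta b x y z t = 0) ->
    (forall b (j : 'I_s) z, \sum_x \sum_y \sum_t
       V j q0 x * V j q1 y * V j q3 t * beta b x y z t = 0) ->
    (forall b (j : 'I_s) t, \sum_x \sum_y \sum_z
       V j q0 x * V j q1 y * V j q2 z * beta b x y z t = 0) ->
    (forall c : I -> F, (forall x y z t, \sum_b c b * beta b x y z t = 0) -> forall b, c b = 0) ->
  (\rank (jacobian (secant_map F s n) v) + #|I| <= #|tensor_index n|)%N.
Proof.
move=> V tan0 tan1 tan2 tan3 ind.
apply: (@rank_conormal _ _ _ _ _ _ (fun b x => beta b (x q0) (x q1) (x q2) (x q3))); last first.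
  move=> c c0; apply: ind => x y z t.
  pose X : tensor_index n :=
    [ffun i : 'I_4 => inord (nth 0%N [:: x : nat; y : nat; z : nat; t : nat] i)].
  by have := c0 X; rewrite !ffunE !inord_val.
move=> b j; apply: ord4_ind => l.
- rewrite -[RHS](tan0 b j l); under eq_bigr do rewrite prod4_but.
  rewrite (big_tensor4 (fun x y z t => (x == l)%:R
    * (V j q1 y * V j q2 z * V j q3 t) * beta b x y z t)).
  rewrite (bigD1 l) //= [X in _ + X]big1 ?addr0 => [|x /negPf ->].
    by apply: eq_bigr => y _; apply: eq_bigr => z _; apply: eq_bigr => t _; rewrite eqxx mul1r.
  by rewrite big1 // => y _; rewrite big1 // => z _; rewrite big1 // => t _; rewrite !mul0r.
- rewrite -[RHS](tan1 b j l); under eq_bigr do rewrite prod4_but.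
  rewrite (big_tensor4 (fun x y z t => (y == l)%:R
    * (V j q0 x * V j q2 z * V j q3 t) * beta b x y z t)).
  apply: eq_bigr => x _; rewrite (bigD1 l) //= [X in _ + X]big1 ?addr0 => [|y /negPf ->].
    by apply: eq_bigr => z _; apply: eq_bigr => t _; rewrite eqxx mul1r.
  by rewrite big1 // => z _; rewrite big1 // => t _; rewrite !mul0r.
- rewrite -[RHS](tan2 b j l); under eq_bigr do rewrite prod4_but.
  rewrite (big_tensor4 (fun x y z t => (z == l)%:R
    * (V j q0 x * V j q1 y * V j q3 t) * beta b x y z t)).
  apply: eq_bigr => x _; apply: eq_bigr => y _.
  rewrite (bigD1 l) //= [X in _ + X]big1 ?addr0 => [|z /negPf ->].
    by apply: eq_bigr => t _; rewrite eqxx mul1r.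
  by rewrite big1 // => t _; rewrite !mul0r.
- rewrite -[RHS](tan3 b j l); under eq_bigr do rewrite prod4_but.
  rewrite (big_tensor4 (fun x y z t => (t == l)%:R
    * (V j q0 x * V j q1 y * V j q2 z) * beta b x y z t)).
  apply: eq_bigr => x _; apply: eq_bigr => y _; apply: eq_bigr => z _.
  rewrite (bigD1 l) //= [X in _ + X]big1 ?addr0 => [|t /negPf ->].
    by rewrite eqxx mul1r.
  by rewrite !mul0r.
Qed.
End FourFactors.

Section Flattenings.
Local Open Scope ring_scope.
Variable F : fieldType.

(** Six unknowns, five equations. *)
Lemma annihilating_form (a : 'I_5 -> 'I_2 -> F) (c : 'I_5 -> 'I_3 -> F) :
  exists u : 'I_2 -> 'I_3 -> F,
    (forall j, \sum_x \sum_z a j x * c j z * u x z = 0) /\ exists x z, u x z != 0.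
Proof.
pose M : 'M[F]_(2 * 3, 5) := \matrix_(i, j) mxvec (\matrix_(x, z) (a j x * c j z)) 0 i.
have: kermx M != 0.
  rewrite -mxrank_eq0 mxrank_ker subn_eq0 -ltnNge.
  exact: leq_ltn_trans (rank_leq_col M) _.
case/rowV0Pn => r /sub_kermxP rM /rV0Pn[i nz_i].
exists (fun x z => r 0 (mxvec_index x z)); split=> [j|].
  have /rowP/(_ j) := rM; rewrite [RHS]mxE mxE (reindex _ (curry_mxvec_bij _ _)) => E.
  rewrite -[RHS]E pair_bigA; apply: eq_bigr => -[x z] _.
  by rewrite mxE mxvecE mxE mulrC.
by case/mxvec_indexP: i nz_i => x z nz; exists x, z.
Qed.

(** A product of two linear forms that vanishes at five general pairs: one
    factor would vanish at two of the a_j or at four of the c_j. *)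
Lemma rank_one_annihilator_eq0 (a : 'I_5 -> 'I_2 -> F) (c : 'I_5 -> 'I_3 -> F) 
    (u : 'I_2 -> 'I_3 -> F) alpha gamma :
    (forall i j, i != j ->
      a i ord0 * a j (lift ord0 ord0) - a i (lift ord0 ord0) * a j ord0 != 0) ->
    (forall j : 'I_5, \det (\matrix_(i < 3, l < 3) c (lift j (lift ord_max i)) l) != 0) ->
    (forall j, \sum_x \sum_z a j x * c j z * u x z = 0) ->
    (forall x z, u x z = alpha x * gamma z) ->
  forall x z, u x z = 0.
Proof.
move=> a_indep c_indep u0 uE x z.
have prod0 j : (\sum_x a j x * alpha x) * (\sum_z c j z * gamma z) = 0.
  rewrite -[RHS](u0 j) big_distrlr; apply: eq_bigr => x' _; apply: eq_bigr => z' _ /=.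
  by rewrite uE mulrACA.
have [j aj0] : exists j, forall i, i != j -> \sum_x a i x * alpha x = 0 -> forall x, alpha x = 0.
  have [/existsP[j /eqP aj0]|/existsPn no_j] := boolP [exists j, \sum_x a j x * alpha x == 0].
    exists j => i ne_ij ai0 x'; apply: (mulfI (a_indep i j ne_ij)); rewrite mulr0.
    case: (unliftP ord0 x') => [x1|] ->.
      rewrite (ord1 x1).
      transitivity (a i ord0 * (\sum_x a j x * alpha x) - a j ord0 * (\sum_x a i x * alpha x)).
        by rewrite !big_ord_recl !big_ord0; ring.
      by rewrite ai0 aj0 !mulr0 subrr.
    transitivity (a j (lift ord0 ord0) * (\sum_x a i x * alpha x)
      - a i (lift ord0 ord0) * (\sum_x a j x * alpha x)).
      by rewrite !big_ord_recl !big_ord0; ring.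
    by rewrite ai0 aj0 !mulr0 subrr.
  by exists ord0 => i _ /eqP ai0; case/negP: (no_j i).
have [/existsP[x0 nz_x0]|/existsPn alpha0] := boolP [exists x, alpha x != 0]; last first.
  by rewrite uE (eqP (negbNE (alpha0 x))) mul0r.
suff -> : u x z = alpha x * 0 by rewrite mulr0.
rewrite uE; congr (_ * _); move: z; apply: (nonsingular_system_eq0 (c_indep j)) => i.
have /eqP := prod0 (lift j (lift ord_max i)); rewrite mulf_eq0 => /orP[/eqP|/eqP //].
move/(aj0 _ _) => a0; case/eqP: nz_x0; apply: a0.
by rewrite eq_sym neq_lift.
Qed.

(** Five summands have rank at most five in each of the 6 x 6 flattenings
    (13)(24) and (14)(23), so both determinants vanish on the secant variety.
    Their differentials are products of a form killing the left factors and
    a form killing the right ones; were they proportional, the first form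
    would have rank one. *)
Lemma conormals_1122 (a b : 'I_5 -> 'I_2 -> F) (c d : 'I_5 -> 'I_3 -> F) :
    (forall i j, i != j ->
      a i ord0 * a j (lift ord0 ord0) - a i (lift ord0 ord0) * a j ord0 != 0) ->
    (forall j : 'I_5, \det (\matrix_(i < 3, l < 3) c (lift j (lift ord_max i)) l) != 0) ->
  exists beta : bool -> 'I_2 -> 'I_2 -> 'I_3 -> 'I_3 -> F,
  [/\ forall i j x, \sum_y \sum_z \sum_t b j y * c j z * d j t * beta i x y z t = 0,
      forall i j y, \sum_x \sum_z \sum_t a j x * c j z * d j t * beta i x y z t = 0,
      forall i j z, \sum_x \sum_y \sum_t a j x * b j y * d j t * beta i x y z t = 0,
      forall i j t, \sum_x \sum_y \sum_z a j x * b j y * c j z * beta i x y z t = 0 &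
      forall e : bool -> F, (forall x y z t, \sum_i e i * beta i x y z t = 0) ->
        forall i, e i = 0].
Proof.
move=> a_indep c_indep.
have [u [u0 nz_u]] := annihilating_form a c; have [w [w0 nz_w]] := annihilating_form b d.
have [u' [u'0 nz_u']] := annihilating_form a d; have [w' [w'0 nz_w']] := annihilating_form b c.
exists (fun i x y z t => if i then u x z * w y t else u' x t * w' y z).
split.
- case=> j x.
    transitivity ((\sum_z c j z * u x z) * \sum_y \sum_t b j y * d j t * w y t).
      rewrite mulr_sumr; apply: eq_bigr => y _; rewrite mulr_suml; apply: eq_bigr => z _.
      by rewrite mulr_sumr; apply: eq_bigr => t _; ring.
    by rewrite w0 mulr0.
  transitivity ((\sum_t d j t * u' x t) * \sum_y \sum_z b j y * c j z * w' y z).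
    rewrite mulr_sumr; apply: eq_bigr => y _; rewrite mulr_sumr; apply: eq_bigr => z _.
    by rewrite mulr_suml; apply: eq_bigr => t _; ring.
  by rewrite w'0 mulr0.
- case=> j y.
    transitivity ((\sum_x \sum_z a j x * c j z * u x z) * \sum_t d j t * w y t).
      rewrite mulr_suml; apply: eq_bigr => x _; rewrite mulr_suml; apply: eq_bigr => z _.
      by rewrite mulr_sumr; apply: eq_bigr => t _; ring.
    by rewrite u0 mul0r.
  transitivity ((\sum_x \sum_t a j x * d j t * u' x t) * \sum_z c j z * w' y z).
    rewrite mulr_suml; apply: eq_bigr => x _; rewrite mulr_sumr; apply: eq_bigr => z _.
    by rewrite mulr_suml; apply: eq_bigr => t _; ring.
  by rewrite u'0 mul0r.
- case=> j z.
    transitivity ((\sum_x a j x * u x z) * \sum_y \sum_t b j y * d j t * w y t).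
      rewrite mulr_suml; apply: eq_bigr => x _; rewrite mulr_sumr; apply: eq_bigr => y _.
      by rewrite mulr_sumr; apply: eq_bigr => t _; ring.
    by rewrite w0 mulr0.
  transitivity ((\sum_x \sum_t a j x * d j t * u' x t) * \sum_y b j y * w' y z).
    rewrite mulr_suml; apply: eq_bigr => x _; rewrite mulr_sumr; apply: eq_bigr => y _.
    by rewrite mulr_suml; apply: eq_bigr => t _; ring.
  by rewrite u'0 mul0r.
- case=> j t.
    transitivity ((\sum_x \sum_z a j x * c j z * u x z) * \sum_y b j y * w y t).
      rewrite mulr_suml; apply: eq_bigr => x _; rewrite mulr_sumr; apply: eq_bigr => y _.
      by rewrite mulr_suml; apply: eq_bigr => z _; ring.
    by rewrite u0 mul0r.
  transitivity ((\sum_x a j x * u' x t) * \sum_y \sum_z b j y * c j z * w' y z).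
    rewrite mulr_suml; apply: eq_bigr => x _; rewrite mulr_sumr; apply: eq_bigr => y _.
    by rewrite mulr_sumr; apply: eq_bigr => z _; ring.
  by rewrite w'0 mulr0.
move=> e e0.
have {}e0 x y z t : e true * (u x z * w y t) + e false * (u' x t * w' y z) = 0.
  by have := e0 x y z t; rewrite big_bool.
have e_true : e true = 0.
  apply/eqP; apply: contraT => nz_e; have [y [t nz_wyt]] := nz_w.
  have nz : e true * w y t != 0 by rewrite mulf_neq0.
  have uE x z : u x z = u' x t * (- e false / (e true * w y t) * w' y z).
    have main : e true * w y t * u x z = - (e false * (u' x t * w' y z)).
      apply/eqP; rewrite -addr_eq0 -[X in _ == X](e0 x y z t); apply/eqP; ring.
    by apply: (mulfI nz); rewrite main; field; rewrite nz_e nz_wyt.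
  have u_eq0 := rank_one_annihilator_eq0 a_indep c_indep u0 uE.
  by have [x [z]] := nz_u; rewrite u_eq0 eqxx.
case=> //; have [x [t nz_x]] := nz_u'; have [y [z nz_y]] := nz_w'.
have /eqP := e0 x y z t; rewrite e_true mul0r add0r !mulf_eq0 (negPf nz_x) (negPf nz_y).
by rewrite !orbF => /eqP.
Qed.
End Flattenings.

(** * Generic points and the expected dimension *)

Section Genericity.
Local Open Scope ring_scope.
Variable F : fieldType.
Hypothesis charF0 : [pchar F] =i pred0.

Variables (s k : nat) (n : k.-tuple nat).
Local Notation m := #|param s n|.

Definition generic_pairs (i : 'I_k) (l0 l1 : 'I_(tnth n i).+1) : {mpoly F[m]} :=
  \prod_(j1 < s) \prod_(j2 < s | j1 != j2)
    ('X_(@par s k n j1 i l0) * 'X_(@par s k n j2 i l1)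
     - 'X_(@par s k n j1 i l1) * 'X_(@par s k n j2 i l0)).

Lemma generic_pairsP i l0 l1 v : (generic_pairs l0 l1).@[v] != 0 <->
  forall j1 j2, j1 != j2 ->
    v (@par s k n j1 i l0) * v (@par s k n j2 i l1)
    - v (@par s k n j1 i l1) * v (@par s k n j2 i l0) != 0.
Proof.
have E j1 j2 : ('X_(@par s k n j1 i l0) * 'X_(@par s k n j2 i l1)
     - 'X_(@par s k n j1 i l1) * 'X_(@par s k n j2 i l0)).@[v]
   = v (@par s k n j1 i l0) * v (@par s k n j2 i l1)
    - v (@par s k n j1 i l1) * v (@par s k n j2 i l0).
  by rewrite mevalB !mevalM !mevalXU.
rewrite rmorph_prod; split=> [/prodf_neq0 nz j1 j2 ne_j|nz].
  have := nz j1 isT; rewrite rmorph_prod => /prodf_neq0/(_ j2 ne_j).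
  by rewrite /= E.
apply/prodf_neq0 => j1 _; rewrite rmorph_prod; apply/prodf_neq0 => j2 ne_j.
by rewrite /= E nz.
Qed.

Definition generic_minors d (r : 'I_s -> 'I_d -> 'I_s) (i : 'I_k)
    (c : 'I_d -> 'I_(tnth n i).+1) : {mpoly F[m]} :=
  \prod_(j < s) \det (\matrix_(p < d, l < d) ('X_(@par s k n (r j p) i (c l)) : {mpoly F[m]})).

Lemma generic_minorsP d r i c v : (@generic_minors d r i c).@[v] != 0 <->
  forall j, \det (\matrix_(p < d, l < d) v (@par s k n (r j p) i (c l))) != 0.
Proof.
have E j : (\det (\matrix_(p < d, l < d) ('X_(@par s k n (r j p) i (c l)) : {mpoly F[m]}))).@[v]
    = \det (\matrix_(p < d, l < d) v (@par s k n (r j p) i (c l))).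
  rewrite -det_map_mx; congr (\det _); apply/matrixP => p l; rewrite !mxE.
  exact: mevalXU.
rewrite rmorph_prod; split=> [/prodf_neq0 nz j|nz].
  by rewrite -E; apply: nz.
by apply/prodf_neq0 => j _; rewrite /= E.
Qed.

Lemma curve_point_pairs i (l0 l1 : 'I_(tnth n i).+1) : l0 = 0%N :> nat -> l1 = 1%N :> nat ->
  (generic_pairs l0 l1).@[nat_point (curve_point F)] != 0.
Proof.
move=> l0E l1E; apply/generic_pairsP => j1 j2 ne_j.
rewrite !nat_point_par /curve_point l0E l1E muln0 muln1 !expn0 mul1r mulr1 subr_eq0.
by apply: contra_neq ne_j => /(natr_inj charF0)/eqP; rewrite eqn_exp2r // => /eqP/val_inj.
Qed.

Lemma curve_point_minors d (r : 'I_s -> 'I_d -> 'I_s) (i : 'I_k)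
    (c : 'I_d -> 'I_(tnth n i).+1) : (forall j, injective (r j)) -> (forall l, c l = l :> nat) ->
  (@generic_minors d r i c).@[nat_point (curve_point F)] != 0.
Proof.
move=> inj_r cE; apply/generic_minorsP => j.
pose t : 'rV[F]_d := \row_p (r j p ^ i.+1)%:R.
rewrite -det_tr (_ : _^T = Vandermonde d t); last first.
  by apply/matrixP => l p; rewrite !mxE nat_point_par /curve_point cE expnM natrX.
rewrite det_Vandermonde; apply/prodf_neq0 => p _; apply/prodf_neq0 => q lt_pq.
rewrite !mxE subr_eq0; apply/eqP => /(natr_inj charF0)/eqP.
rewrite eqn_exp2r // => /eqP/val_inj/inj_r eq_qp.
by rewrite eq_qp ltnn in lt_pq.
Qed.
End Genericity.

Section Criteria.
Local Open Scope ring_scope.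
Variable F : fieldType.
Hypothesis charF0 : [pchar F] =i pred0.
Variables (k : nat) (n : k.-tuple nat).
Hypothesis k_gt0 : (0 < k)%N.

Lemma card_tensor_index : #|tensor_index n| = (\prod_(i < k) (tnth n i).+1)%N.
Proof.
rewrite /tensor_index card_dep_ffun foldrE big_image /=.
by apply: eq_bigr => i _; rewrite card_ord.
Qed.

Lemma expected_dimE : (expected_dim 5 n).+1
  = minn #|tensor_index n| (5 * (\sum_(i < k) tnth n i).+1).
Proof.
have N_gt0 : (0 < \prod_(i < k) (tnth n i).+1)%N by apply: prodn_gt0.
rewrite card_tensor_index /expected_dim; move: N_gt0.
move: (\prod_(i < k) _)%N (\sum_(i < k) _)%N => N S; lia.
Qed.

Lemma nondefective_of_rank v :
    (minn #|tensor_index n| (5 * (\sum_(i < k) tnth n i).+1)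
      <= \rank (jacobian (secant_map F 5 n) v))%N ->
  segre_nondefective F 5 n.
Proof.
rewrite -expected_dimE => rk_ge.
apply: (has_dim_of_rank charF0 (secant_vanishing charF0 (Ordinal k_gt0) ord0) rk_ge).
  exact: initial_coordinates_neq0.
move=> w nz_w; rewrite expected_dimE leq_min rank_leq_row /=.
exact: rank_le_normalized.
Qed.

Lemma defective_of_rank (h : {mpoly F[#|param 5 n|]}) : h != 0 ->
    (forall v, h.@[v] != 0 ->
      (\rank (jacobian (secant_map F 5 n) v) <= expected_dim 5 n)%N) ->
  segre_defective F 5 n.
Proof.
move=> nz_h le_h.
apply: (has_dim_lt_of_rank charF0 (secant_vanishing charF0 (Ordinal k_gt0) ord0) _ nz_h le_h
  (v0 := fun _ => 1)).
rewrite lt0n mxrank_eq0; apply/eqP => /matrixP J0.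
pose x : 'I_#|tensor_index n| := 
  enum_rank ([ffun i : 'I_k => ord0 : 'I_(tnth n i).+1] : tensor_index n).
have := J0 x (@par 5 k n ord0 (Ordinal k_gt0) (multi_index x (Ordinal k_gt0))).
rewrite jacobian_secant_map eqxx mul1r big1 // mxE => /eqP.
by rewrite oner_eq0.
Qed.
End Criteria.

(** * The classification *)

Section Classification.
Local Open Scope ring_scope.
Variable F : fieldType.
Hypothesis charF0 : [pchar F] =i pred0.

(** Every format outside the list of exceptions is bounded below by one of
    these, or bounded above by a perfect one, (1,4,4), (2,2,4) or (1,1,1,4), or
    is of the form (1,1,a). *)
Definition base_formats : seq (seq nat) :=
  [:: [:: 1; 4; 4]; [:: 2; 2; 4]; [:: 3; 3; 3]; [:: 1; 1; 1; 4]; [:: 1; 1; 2; 3];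
      [:: 1; 2; 2; 2]; [:: 1; 1; 1; 1; 1]]%N.

(** Any prime would do modulo which the elimination succeeds in all seven
    formats; 23 keeps the numbers small. *)
Lemma base_formats_independent n0 : n0 \in base_formats ->
  independent_tangents 5 (size n0) (nth 0%N n0) (curve_point F).
Proof.
have /allP chk : all (fun n => rows_independent (N.of_nat 23) (size (tangent_rows 5 n))
    (tangent_rows 5 n)) base_formats by vm_compute.
have pr_p : prime (N.to_nat (N.of_nat 23)) by vm_compute.
by move/chk => ind; exact (curve_points_independent pr_p charF0 ind).
Qed.

Lemma nondefective_above k (n : k.-tuple nat) n0 : n0 \in base_formats -> (size n0 <= k)%N ->
    (forall i, (i < size n0)%N -> (nth 0 n0 i <= nth 0 n i)%N) ->
  segre_nondefective F 5 n.
Proof.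
move=> n0_base le_k le_n.
have size_gt0 : {in base_formats, forall n1 : seq nat, 0 < size n1}%N by exact/allP.
have k_gt0 : (0 < k)%N.
  exact: leq_trans (size_gt0 _ n0_base) le_k.
apply: (nondefective_of_rank charF0 k_gt0 (v := nat_point (truncate n0 (curve_point F)))).
apply: leq_trans (geq_minr _ _) _; apply: rank_ge_independent => //.
apply: independent_tangents_extend.
- by move=> j i; rewrite /curve_point muln0 expn0.
- by rewrite le_k (size_gt0 _ n0_base).
- move=> i _; have [/le_n //|ge_i] := ltnP i (size n0).
  by rewrite nth_default.
exact: base_formats_independent.
Qed.

(** In a perfect format five independent tangent spaces fill the space, and
    they still do after projection to a smaller format. *)
Lemma nondefective_below k (n n0 : k.-tuple nat) : (0 < k)%N -> tval n0 \in base_formats ->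
    (\prod_(i < k) (tnth n0 i).+1 = 5 * (\sum_(i < k) tnth n0 i).+1)%N ->
    (forall i, (nth 0 n i <= nth 0 n0 i)%N) ->
  segre_nondefective F 5 n.
Proof.
move=> k_gt0 n0_base perfect le_n.
apply: (nondefective_of_rank charF0 k_gt0 (v := nat_point (curve_point F))).
apply: leq_trans (geq_minl _ _) _.
suff: row_free (jacobian (secant_map F 5 n) (nat_point (curve_point F))).
  by move/eqP->.
apply: (@rank_full_truncate _ _ _ n n0) => [i|]; first by rewrite !(tnth_nth 0%N).
rewrite /row_free eqn_leq rank_leq_row [leqLHS]card_tensor_index perfect.
apply: rank_ge_independent => //.
by have := base_formats_independent n0_base; rewrite size_tuple.
Qed.

(** Four summands already fill F^2 (x) F^2 (x) V: take a basis of pure tensors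
    of the first two factors. *)
Lemma nondefective_11a (n : 3.-tuple nat) : tnth n t0 = 1%N -> tnth n t1 = 1%N ->
  segre_nondefective F 5 n.
Proof.
move=> n0 n1; pose V j i l : F := (if i == 0%N then l == j./2 else l == odd j)%:R.
apply: (@nondefective_of_rank F charF0 3 n isT (nat_point V)).
apply: leq_trans (geq_minl _ _) _; set J := jacobian _ _.
suff: row_free J by move/eqP->.
apply: inj_row_free => u uJ; apply/rowP => x; rewrite [RHS]mxE.
have lt2 (i : 'I_3) (y : 'I_#|tensor_index n|) : tnth n i = 1%N -> (multi_index y i < 2)%N.
  by move=> ni; apply: leq_trans (ltn_ord (multi_index y i)) _; rewrite ni.
have x0 := lt2 t0 x n0; have x1 := lt2 t1 x n1.
(* The summand 2 x_0 + x_1 is e_(x_0) (x) e_(x_1) (x) _, so varying its third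
   factor along e_(x_2) gives the basis tensor at x. *)
have lt5 : (multi_index x t0 * 2 + multi_index x t1 < 5)%N by lia.
have half_j : (multi_index x t0 * 2 + multi_index x t1)./2 = multi_index x t0 by lia.
have odd_j : odd (multi_index x t0 * 2 + multi_index x t1) = multi_index x t1 :> nat by lia.
have JE y : J y (@par 5 3 n (Ordinal lt5) t2 (multi_index x t2)) = (y == x)%:R.
  rewrite jacobian_secant_map prod3_but !nat_point_par /V /= half_j odd_j -!natrM !mulnb.
  congr (nat_of_bool _)%:R.
  apply/and3P/eqP => [[/eqP E2 /eqP E0 /eqP E1]|->]; last by rewrite !eqxx.
  apply/enum_val_inj/ffunP => i; apply: val_inj => /=.
  case: (unliftP ord0 i) => [i1|] ->; last exact: E0.
  case: (unliftP ord0 i1) => [i2|] ->; last exact: E1.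
  by rewrite (ord1 i2); apply: (congr1 (@nat_of_ord _) E2).
have /rowP/(_ (@par 5 3 n (Ordinal lt5) t2 (multi_index x t2))) := uJ; clearbody J.
rewrite !mxE (bigD1 x) //= JE eqxx mulr1 big1 ?addr0 // => y ne_yx.
by rewrite JE (negPf ne_yx) mulr0.
Qed.

(** The flattening of size 2(b+1) by a+1 yields (2(b+1)-5)(a-4) hyperplanes. *)
Lemma defective_unbalanced (n : 3.-tuple nat) (b a : nat) : (b == 2) || (b == 3) -> (5 <= a)%N ->
  tval n = [:: 1; b; a]%N -> segre_defective F 5 n.
Proof.
move=> b23 le_a nE.
have [n0 n1 n2] : [/\ tnth n t0 = 1, tnth n t1 = b & tnth n t2 = a]%N.
  by rewrite !(tnth_nth 0%N) nE.
apply: (@defective_of_rank F charF0 3 n isT 1) => //; first exact: oner_neq0.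
move=> v _; have := rank_unbalanced (s := 5) v.
move: (\rank _) => r; rewrite /expected_dim card_tensor_index !big_ord_recl !big_ord0.
rewrite -/t0 -/t1 -/t2 n0 n1 n2.
by case/orP: b23 => /eqP ->; lia.
Qed.

(** Four hyperplanes in F^48 leave rank 44, one less than the expected 45. *)
Lemma defective_233 (n : 3.-tuple nat) : tval n = [:: 2; 3; 3]%N -> segre_defective F 5 n.
Proof.
move=> nE; have {nE} -> : n = [tuple 2; 3; 3]%N by apply: val_inj.
set n' : 3.-tuple nat := [tuple 2; 3; 3]%N.
pose h0 : {mpoly F[#|param 5 n'|]} := initial_coordinates F 5 n'.
pose h1 : {mpoly F[#|param 5 n'|]} :=
  @generic_pairs F 5 3 n' t0 (ord0 : 'I_3) (lift ord0 ord0 : 'I_3).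
pose h2 : {mpoly F[#|param 5 n'|]} :=
  @generic_minors F 5 3 n' 4 (fun j p => lift j p) t1 (fun l => l : 'I_4).
pose h3 : {mpoly F[#|param 5 n'|]} :=
  @generic_minors F 5 3 n' 4 (fun j p => lift j p) t2 (fun l => l : 'I_4).
have neq0 (h : {mpoly F[#|param 5 n'|]}) v : h.@[v] != 0 -> h != 0.
  by apply: contra_neq => ->; rewrite meval0.
apply: (@defective_of_rank F charF0 _ n' isT (h0 * h1 * h2 * h3)) => //.
  rewrite !mulf_neq0 ?initial_coordinates_neq0 //; apply: neq0.
  - exact: curve_point_pairs.
  - by apply: curve_point_minors => // j; apply: lift_inj.
  - by apply: curve_point_minors => // j; apply: lift_inj.
move=> v; rewrite !mevalM !mulf_eq0 !negb_or => /andP[/andP[/andP[nz0]]].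
move=> /generic_pairsP pairs /generic_minorsP mb /generic_minorsP mc.
have nz_v j : v (@par 5 3 n' j t0 ord0) != 0.
  move: nz0; rewrite rmorph_prod => /prodf_neq0/(_ j isT).
  by rewrite rmorph_prod => /prodf_neq0/(_ t0 isT); rewrite /= mevalXU.
have [I [beta [I_ge4 tan0 tan1 tan2 ind]]] :=
  @conormals_233 F (fun j x => v (@par 5 3 n' j t0 x)) (fun j x => v (@par 5 3 n' j t1 x))
    (fun j x => v (@par 5 3 n' j t2 x)) nz_v pairs mb mc.
have := @rank_conormal3 F 5 n' v I beta tan0 tan1 tan2 ind.
move: (\rank _) => r; rewrite /expected_dim card_tensor_index !big_ord_recl !big_ord0.
rewrite -/t0 -/t1 -/t2 -[tnth n' t0]/2%N -[tnth n' t1]/3%N -[tnth n' t2]/3%N; lia.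
Qed.

(** Two hyperplanes in F^36 leave rank 34, one less than the expected 35. *)
Lemma defective_1122 (n : 4.-tuple nat) : tval n = [:: 1; 1; 2; 2]%N -> segre_defective F 5 n.
Proof.
move=> nE; have {nE} -> : n = [tuple 1; 1; 2; 2]%N by apply: val_inj.
set n' : 4.-tuple nat := [tuple 1; 1; 2; 2]%N.
pose h1 : {mpoly F[#|param 5 n'|]} :=
  @generic_pairs F 5 4 n' q0 (ord0 : 'I_2) (lift ord0 ord0 : 'I_2).
pose h2 : {mpoly F[#|param 5 n'|]} :=
  @generic_minors F 5 4 n' 3 (fun j p => lift j (lift ord_max p)) q2 (fun l => l : 'I_3).
have neq0 (h : {mpoly F[#|param 5 n'|]}) v : h.@[v] != 0 -> h != 0.
  by apply: contra_neq => ->; rewrite meval0.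
apply: (@defective_of_rank F charF0 _ n' isT (h1 * h2)) => //.
  rewrite mulf_neq0 //; apply: neq0; first exact: curve_point_pairs.
  by apply: curve_point_minors => // j p p' /lift_inj/lift_inj.
move=> v; rewrite mevalM mulf_eq0 negb_or => /andP[/generic_pairsP pairs /generic_minorsP mc].
have [beta [tan0 tan1 tan2 tan3 ind]] :=
  @conormals_1122 F (fun j x => v (@par 5 4 n' j q0 x)) (fun j x => v (@par 5 4 n' j q1 x))
    (fun j x => v (@par 5 4 n' j q2 x)) (fun j x => v (@par 5 4 n' j q3 x)) pairs mc.
have := @rank_conormal4 F 5 n' v bool beta tan0 tan1 tan2 tan3 ind.
move: (\rank _) => r; rewrite /expected_dim card_tensor_index card_bool !big_ord_recl !big_ord0.
rewrite -/q0 -/q1 -/q2 -/q3 -[tnth n' q0]/1%N -[tnth n' q1]/1%N.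
rewrite -[tnth n' q2]/2%N -[tnth n' q3]/2%N; lia.
Qed.
End Classification.

Theorem theorem4p12 (F : fieldType) (charF0 : [pchar F]%R =i pred0)
    (k : nat) (hk : 3 <= k) (n : k.-tuple nat)
    (n_ge1 : forall i : 'I_k, 1 <= tnth n i)
    (n_le : forall i j : 'I_k, i <= j -> tnth n i <= tnth n j) :
  let exceptional :=
    [\/ tval n = [:: 2; 3; 3],
        (exists a : nat, 5 <= a /\ tval n = [:: 1; 2; a]),
        (exists a : nat, 5 <= a /\ tval n = [:: 1; 3; a])
      | tval n = [:: 1; 1; 2; 2]] in
  (exceptional -> segre_defective F 5 n) /\
  (~ exceptional -> segre_nondefective F 5 n).
Proof.
cbv zeta; have ge1 i : i < k -> 0 < nth 0 n i.
  by move=> lt_i; have := n_ge1 (Ordinal lt_i); rewrite (tnth_nth 0).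
have le i j : i <= j -> j < k -> nth 0 n i <= nth 0 n j.
  move=> le_ij lt_j; have := n_le (Ordinal (leq_ltn_trans le_ij lt_j)) (Ordinal lt_j) le_ij.
  by rewrite !(tnth_nth 0).
clear n_ge1 n_le; case: k hk n ge1 le => [|[|[|[|[|k]]]]] // _ n ge1 le.
- case: n ge1 le => -[|a [|b [|c [|]]]] // sz ge1 le.
  split=> [[nE|[c' [c_ge5 nE]]|[c' [c_ge5 nE]]|//]|no_exc].
  - exact: defective_233.
  - exact: (@defective_unbalanced F charF0 (Tuple sz) 2 c').
  - exact: (@defective_unbalanced F charF0 (Tuple sz) 3 c').
  have a_gt0 : 0 < a := ge1 0 isT.
  have le_ab : a <= b := le 0 1 isT isT; have le_bc : b <= c := le 1 2 isT isT.
  have above (a0 b0 c0 : nat) : [:: a0; b0; c0] \in base_formats ->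
      [&& a0 <= a, b0 <= b & c0 <= c] -> segre_nondefective F 5 (Tuple sz).
    move=> n0_base /and3P[le_a le_b le_c].
    apply: (nondefective_above charF0 n0_base) => //.
    by case=> [|[|[|]]].
  have below (n0 : 3.-tuple nat) : tval n0 \in base_formats ->
      \prod_(i < 3) (tnth n0 i).+1 = 5 * (\sum_(i < 3) tnth n0 i).+1 ->
      [&& a <= nth 0 n0 0, b <= nth 0 n0 1 & c <= nth 0 n0 2] ->
      segre_nondefective F 5 (Tuple sz).
    move=> n0_base perfect /and3P[le_a le_b le_c].
    apply: (nondefective_below charF0 (n0 := n0)) => //.
    by case=> [|[|[|i]]] //=; rewrite nth_nil.
  have [a1|a_ge2] := leqP a 1.
    have [b1|b_ge2] := leqP b 1.
      apply: nondefective_11a => //; rewrite (tnth_nth 0) /=; lia.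
    have [b_ge4|b_le3] := leqP 4 b; first by apply: (above 1 4 4) => //; lia.
    have [c_le4|c_ge5] := leqP c 4.
      by apply: (below [tuple 1; 4; 4]) => //=; [rewrite !big_ord_recl !big_ord0 | lia].
    case: no_exc; have -> : a = 1 by lia.
    have [->|->] : b = 2 \/ b = 3 by lia.
      by apply: Or42; exists c.
    by apply: Or43; exists c.
  have [a_ge3|a2] := leqP 3 a; first by apply: (above 3 3 3) => //; lia.
  have [c_ge4|c_le3] := leqP 4 c; first by apply: (above 2 2 4) => //; lia.
  have [b_le2|b_ge3] := leqP b 2.
    by apply: (below [tuple 2; 2; 4]) => //=; [rewrite !big_ord_recl !big_ord0 | lia].
  case: no_exc; apply: Or41; congr [:: _; _; _]; lia.
- case: n ge1 le => -[|a [|b [|c [|d [|]]]]] // sz ge1 le.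
  split=> [[//|[? [_ //]]|[? [_ //]]|nE]|no_exc]; first exact: defective_1122.
  have a_gt0 : 0 < a := ge1 0 isT; have le_ab : a <= b := le 0 1 isT isT.
  have le_bc : b <= c := le 1 2 isT isT; have le_cd : c <= d := le 2 3 isT isT.
  have above (a0 b0 c0 d0 : nat) : [:: a0; b0; c0; d0] \in base_formats ->
      [&& a0 <= a, b0 <= b, c0 <= c & d0 <= d] -> segre_nondefective F 5 (Tuple sz).
    move=> n0_base /and4P[le_a le_b le_c le_d].
    apply: (nondefective_above charF0 n0_base) => //.
    by case=> [|[|[|[|]]]].
  have [b_ge2|b1] := leqP 2 b; first by apply: (above 1 2 2 2) => //; lia.
  have [c_ge2|c1] := leqP 2 c.
    have [d_ge3|d2] := leqP 3 d; first by apply: (above 1 1 2 3) => //; lia.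
    case: no_exc; apply: Or44; congr [:: _; _; _; _]; lia.
  have [d_ge4|d_le3] := leqP 4 d; first by apply: (above 1 1 1 4) => //; lia.
  apply: (nondefective_below charF0 (n0 := [tuple 1; 1; 1; 4])) => //.
    by rewrite !big_ord_recl !big_ord0.
  by case=> [|[|[|[|i]]]] //=; rewrite ?nth_nil //; lia.
split=> [[nE|[? [_ nE]]|[? [_ nE]]|nE]|_];
  try by have := congr1 size nE; rewrite size_tuple.
(* Five factors or more: five copies of the projective line are enough. *)
apply: (nondefective_above charF0 (n0 := [:: 1; 1; 1; 1; 1])) => // i lt_i.
rewrite (_ : nth 0 _ i = 1); last by case: i lt_i => [|[|[|[|[|]]]]].
by apply: ge1; apply: leq_trans lt_i _.
Qed.
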